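(* Let $j,k,n,m\ge 1$ be integers, let $\Omega\subseteq\mathbb{C}$ be open, and let $A(x)$ be an $n\times n$ complex matrix depending on $x=(x_1,\dots,x_j)\in\mathbb{R}^j$. Assume that $A$ is $k$ times differentiable at $\bar{x}=(\bar{x}_1,\dots,\bar{x}_j)$ and that $A(x)\in M_n(\Omega,m)$ for all $x$ in some neighborhood of $\bar{x}$. Let $d_1,\dots,d_k\in\{1,\dots,j\}$ and define $$X_0(x)=A(x),\qquad X_i(x)=\begin{bmatrix} X_{i-1}(x) & \frac{\partial}{\partial x_{d_i}}X_{i-1}(x)\\ 0 & X_{i-1}(x)\end{bmatrix},\quad i=1,\dots,k.$$ Let $f$ be $(k+1)m-1$ times continuously differentiable on $\Omega$. Then $f(A(x))$ is $k$ times differentiable at $\bar{x}$ and $F_k(\bar{x})=f(X_k(\bar{x}))$, where $$F_0(x)=f(A(x)),\qquad F_i(x)=\begin{bmatrix} F_{i-1}(x) & \frac{\partial}{\partial x_{d_i}}F_{i-1}(x)\\ 0 & F_{i-1}(x)\end{bmatrix},\quad i=1,\dots,k.$$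
   Context: For an open set $\Omega\subseteq\mathbb{C}$, $M_n(\Omega,m)$ denotes the set of $n\times n$ complex matrices whose spectrum is contained in $\Omega$ and whose largest Jordan block has size at most $m$. For a scalar function $f:\Omega\to\mathbb{C}$ (differentiability on $\Omega$ is with respect to the complex variable), $f(A)$ denotes the matrix function in the standard sense, defined through the Jordan canonical form (equivalently Hermite interpolation) of $A$. ''$k$ times differentiable at $\bar{x}$'' is in the usual sense for functions of several real variables (for $k\ge 1$ this includes $k-1$ times differentiability in a neighborhood of $\bar{x}$); the displayed derivatives are ordinary partial derivatives. *)

(* Defs.v *)
From HB Require Import structures.
From mathcomp Require Import all_boot all_order all_algebra complex.
From mathcomp Require Import all_classical all_reals all_analysis.

Set Implicit Arguments.
Unset Strict Implicit.
Unset Printing Implicit Defensive.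

Import Order.TTheory GRing.Theory Num.Theory.
Import numFieldNormedType.Exports.

Local Open Scope classical_set_scope.
Local Open Scope ring_scope.
Local Open Scope complex_scope.

Section ComplexFunctions.
Variable R : realType.

(* R[i]^o is R[i] seen as a normed space over itself, so that derivable and
   derive1n below refer to the complex variable. *)
Definition cont_diff_on (N : nat) (Omega : set R[i]^o) (f : R[i]^o -> R[i]^o)
  : Prop :=
  (forall l : nat, (l < N)%N ->
     forall z, Omega z -> derivable (derive1n l f) z 1) /\
  (forall z, Omega z -> {for z, continuous (derive1n N f)}).

End ComplexFunctions.

Section MatrixFunctions.
Variable R : realType.
Local Notation C := (R[i]).

Definition jordan_block (s : nat) (lam : C) : 'M[C]_s :=
  \matrix_(a, b) (lam *+ (a == b) + (a.+1 == b)%:R).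

Definition fun_jordan_block (f : R[i]^o -> R[i]^o) (s : nat) (lam : C)
  : 'M[C]_s :=
  \matrix_(a, b) (if (a <= b)%N
                  then (derive1n (b - a) f lam : C) / ((b - a)`!)%:R else 0).

(* A = P J P^-1 with J block diagonal made of Jordan blocks.  Since \mxdiag has
   size \sum_i p i, which is only propositionally equal to n, P and its inverse
   Q are a priori rectangular; the two inverse laws force n = \sum_i p i. *)
Definition jordan_decomposition (n : nat) (A : 'M[C]_n) (r : nat)
    (p : 'I_r -> nat) (lam : 'I_r -> C)
    (P : 'M[C]_(n, \sum_i p i)) (Q : 'M[C]_(\sum_i p i, n)) : Prop :=
  [/\ forall i, (0 < p i)%N,
      P *m Q = 1%:M,
      Q *m P = 1%:M &
      A = P *m (\mxdiag_i jordan_block (p i) (lam i)) *m Q].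

(* The set M_n(Omega, m). *)
Definition spectral_class (n : nat) (Omega : set R[i]^o) (m : nat)
  : set 'M[C]_n :=
  [set A | (forall a : C, eigenvalue A a -> Omega a) /\
     exists (r : nat) (p : 'I_r -> nat) (lam : 'I_r -> C)
            (P : 'M[C]_(n, \sum_i p i)) (Q : 'M[C]_(\sum_i p i, n)),
       jordan_decomposition A lam P Q /\ (forall i, (p i <= m)%N)].

Definition matfun_spec (f : R[i]^o -> R[i]^o) (n : nat) (A : 'M[C]_n)
  : set 'M[C]_n :=
  [set B | exists (r : nat) (p : 'I_r -> nat) (lam : 'I_r -> C)
            (P : 'M[C]_(n, \sum_i p i)) (Q : 'M[C]_(\sum_i p i, n)),
       jordan_decomposition A lam P Q /\
       B = P *m (\mxdiag_i fun_jordan_block f (p i) (lam i)) *m Q].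

(* The matrix f(A).  Every A has a Jordan decomposition and all of them give
   the same element of matfun_spec f A, so the default value 0 and the choice
   made by xget play no role. *)
Definition matfun (f : R[i]^o -> R[i]^o) (n : nat) (A : 'M[C]_n) : 'M[C]_n :=
  xget 0 (matfun_spec f A).

End MatrixFunctions.

Section RealVariables.
Variables (R : realType) (j : nat).
Local Notation C := (R[i]).

Definition partial (i : 'I_j) (g : 'rV[R]_j -> R) : 'rV[R]_j -> R :=
  fun x => 'D_(delta_mx 0 i) g x.

(* For k > 0: g is k - 1 times differentiable in a neighborhood of x, and all
   its partial derivatives of order k - 1 are (Frechet) differentiable at x. *)
Fixpoint k_differentiable (k : nat) (g : 'rV[R]_j -> R) (x : 'rV[R]_j)
  : Prop :=
  match k with
  | 0 => True
  | k'.+1 =>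
      (\forall y \near x, k_differentiable k' g y) /\
      (forall s : k'.-tuple 'I_j, differentiable (foldr partial g s) x)
  end.

(* Complex matrices are differentiated through the real and imaginary parts of
   their entries. *)
Definition mx_k_differentiable (n : nat) (k : nat)
    (G : 'rV[R]_j -> 'M[C]_n) (x : 'rV[R]_j) : Prop :=
  forall a b : 'I_n,
    k_differentiable k (fun y => complex.Re (G y a b)) x /\
    k_differentiable k (fun y => complex.Im (G y a b)) x.

Definition mx_partial (n : nat) (i : 'I_j) (G : 'rV[R]_j -> 'M[C]_n)
  : 'rV[R]_j -> 'M[C]_n :=
  fun x => \matrix_(a, b)
    ((partial i (fun y => complex.Re (G y a b)) x) +i*
     (partial i (fun y => complex.Im (G y a b)) x)).

(* Equal to 2 ^ i * n, in the form expected by block_mx. *)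
Definition block_size (n i : nat) : nat := iter i (fun s => (s + s)%N) n.

(* X_0 = G and X_i = [X_(i-1), d X_(i-1) / d x_(d i); 0, X_(i-1)]; only the
   directions d 1, ..., d i are used. *)
Fixpoint block_derivative (n : nat) (d : nat -> 'I_j)
    (G : 'rV[R]_j -> 'M[C]_n) (i : nat)
  : 'rV[R]_j -> 'M[C]_(block_size n i) :=
  match i with
  | 0 => G
  | i'.+1 => fun x =>
      let X := block_derivative d G i' in
      block_mx (X x) (mx_partial (d i'.+1) X x) 0 (X x)
  end.

End RealVariables.

(* Main.v *)
Require Import Defs.
From HB Require Import structures.
From mathcomp Require Import all_boot all_order all_algebra complex.
From mathcomp Require Import all_classical all_reals all_analysis.
From mathcomp Require Import ring lra zify.

Set Implicit Arguments.
Unset Strict Implicit.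
Unset Printing Implicit Defensive.

Import Order.TTheory GRing.Theory Num.Theory.
Import numFieldNormedType.Exports.

Local Open Scope classical_set_scope.
Local Open Scope ring_scope.
Local Open Scope complex_scope.

(* Since k.+1 * m - 1 >= 1 and differentiability is complex, f is holomorphic on
   Omega, so no bookkeeping of Jordan block sizes is needed.  Cauchy's formula is
   obtained for C^1 functions without integrals: the integral over a circle is
   replaced by the mean over the 2^(nu+1)-th roots of unity, nu -> oo.  Hence,
   near a fixed matrix A0, f(A) is the limit of sum_q w_q (z_q - A)^-1 with
   weights w_q and nodes z_q on circles around the eigenvalues of A0.  The
   resolvent identity gives f(A) - f(A0) = L(A - A0) + O(|A - A0|^2), where L(E)
   is the upper right block of f([A0, E; 0, A0]).  So every partial derivative of
   f(A(x)) is a block of f(X_1(x)), and the theorem follows by induction on k. *)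

(** * Jordan form *)

(** [matfun f] at [A] and at [[A, E; 0, A]] is defined from unrelated Jordan decompositions, and
    block sizes can jump when [A] varies. A limit of sums of resolvents at fixed nodes mentions no
    Jordan form, so it compares all these matrices at once; it also shows that every Jordan
    decomposition of a matrix gives the same value. Identifying the limit with the entries
    [f^(l)(lam) / l!] requires Cauchy's formula for all derivatives. The sums with kernel
    [(z - w)^-m] obey a Taylor estimate whose constants do not depend on the number of nodes, so
    convergence for [m] yields convergence for [m + 1] together with the derivative of the limit.
    Roots of unity make the mean of the Cauchy kernel an exact geometric sum, and those of order a
    power of 2 need only square roots, no exponential. Estimates survive the limit for two reasons:
    the weights have uniformly bounded total modulus, and the nodes stay at a fixed distance from
    the eigenvalues of [A0]. *)

Section Jordan.
Variable R : realType.
Local Notation C := R[i].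

(* A list of blocks with A = sum_b L_b J_b R_b: unlike \mxdiag, it involves no
   sum of sizes in a type, which makes the induction on n painless. *)
Record jblock (n : nat) := JBlock
  { jsize : nat; jval : C; jleft : 'M[C]_(n, jsize); jright : 'M[C]_(jsize, n) }.

Definition jblock0 n : jblock n := JBlock 0 (0 : 'M[C]_(n, 0)) 0.

Definition jordan_seq n (A : 'M[C]_n) (s : seq (jblock n)) : Prop :=
  [/\ forall i, (i < size s)%N -> (0 < jsize (nth (jblock0 n) s i))%N,
      forall i, (i < size s)%N ->
        jright (nth (jblock0 n) s i) *m jleft (nth (jblock0 n) s i) = 1%:M,
      forall i j, (i < size s)%N -> (j < size s)%N -> i != j ->
        jright (nth (jblock0 n) s i) *m jleft (nth (jblock0 n) s j) = 0,
      \sum_(b <- s) jleft b *m jright b = 1%:M &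
      A = \sum_(b <- s) jleft b *m jordan_block (jsize b) (jval b) *m jright b].

(* With (X - lam)^m q the minimal polynomial and B = A - lam, the rows v B^i and
   the columns B^(m-1-i) phi, for a row v and a column phi of q(A), span
   dual invariant subspaces: v B^(m-1) phi <> 0 for a suitable choice. *)
Lemma jordan_chain_split n' (A : 'M[C]_n'.+1) :
  exists (m : nat) (lam : C) (U : 'M[C]_(n'.+1, m)) (V : 'M[C]_(m, n'.+1)),
    [/\ (0 < m)%N, V *m U = 1%:M,
        A *m U = U *m jordan_block m lam & V *m A = jordan_block m lam *m V].
Proof.
have [lam rlam] : exists lam, root (mxminpoly A) lam.
  apply/closed_rootP; rewrite size_mxminpoly eqSS.
  by rewrite -lt0n mxminpoly_nonconstant.
have [m [q nrq def_p]] := multiplicity_XsubC (mxminpoly A) lam.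
have p_neq0 : mxminpoly A != 0 by rewrite monic_neq0 // mxminpoly_monic.
have {}nrq : ~~ root q lam by rewrite p_neq0 in nrq.
have m_gt0 : (0 < m)%N.
  by rewrite lt0n; apply/eqP => m0; move: rlam; rewrite def_p m0 expr0 mulr1 (negPf nrq).
pose B := A - lam%:M.
have BE : B = horner_mx A ('X - lam%:P) by rewrite rmorphB /= horner_mx_X horner_mx_C.
have BXE k : B ^+ k = horner_mx A (('X - lam%:P) ^+ k) by rewrite rmorphXn /= -BE.
pose Q := horner_mx A q.
have QB0 : Q *m B ^+ m = 0.
  have := mx_root_minpoly A; rewrite def_p rmorphM => <-; by rewrite BXE.
have comQB k : Q *m B ^+ k = B ^+ k *m Q.
  by rewrite BXE; apply: comm_horner_mx2.
(* [q^2 (X - lam)^(m-1)] is not a multiple of the minimal polynomial [q (X - lam)^m], since [q] does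
   not vanish at [lam]. *)
have T_neq0 : Q *m B ^+ m.-1 *m Q != 0.
  rewrite BXE -[X in X != 0]/(_ * _ * _) -!rmorphM -dvd_mxminpoly def_p.
  have mE := prednK m_gt0.
  rewrite [X in _ %| X]mulrAC -[X in _ * _ ^+ X %| _]mE exprS mulrA.
  rewrite dvdp_mul2r; last by rewrite expf_neq0 // polyXsubC_eq0.
  apply/negP => dv.
  have : root (q * q) lam.
    rewrite root_factor_theorem; apply: dvdp_trans dv; exact: dvdp_mull.
  by rewrite rootM (negPf nrq).
have [a [b Tab]] : exists a b, (Q *m B ^+ m.-1 *m Q) a b != 0.
  exact/matrix0Pn.
have AB : A = lam%:M + B by rewrite addrC subrK.
pose V := \matrix_(i < m) row a (Q *m B ^+ i).
pose U := \matrix_(i < n'.+1, j < m) (B ^+ (m.-1 - j) *m Q) i b.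
have VA : V *m A = jordan_block m lam *m V.
  apply/row_matrixP => i; rewrite !row_mul rowK; apply/rowP => c.
  have -> : row a (Q *m B ^+ i) *m A = lam *: row a (Q *m B ^+ i) + row a (Q *m B ^+ i.+1).
    rewrite AB mulmxDr -scalemx1 -scalemxAr mulmx1; congr (_ + _).
    by rewrite -row_mul -mulmxA exprSr.
  rewrite !mxE.
  under [RHS]eq_bigr => k _ do rewrite !mxE mulrDl.
  rewrite big_split /= (bigD1 i) //= eqxx mulr1n [X in _ + X + _]big1 ?addr0; last first.
    by move=> k ki; rewrite eq_sym (negPf ki) mulr0n mul0r.
  congr (_ + _).
  case: (ltnP i.+1 m) => im.
    rewrite [RHS](bigD1 (Ordinal im)) //= eqxx mul1r [X in _ + X]big1 ?addr0; last first.
      move=> k ki; case: eqP => [ik|_]; last by rewrite mul0r.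
      by case/eqP: ki; apply/val_inj.
    by [].
  rewrite [RHS]big1 => [|k _]; last first.
    case: eqP => [ik|_]; last by rewrite mul0r.
    by move: (ltn_ord k); rewrite -ik ltnNge im.
  have -> : i.+1 = m by apply/eqP; rewrite eqn_leq ltn_ord.
  have /matrixP/(_ a c) := QB0; by rewrite !mxE.
have AU : A *m U = U *m jordan_block m lam.
  apply/matrixP => i j.
  have -> : (A *m U) i j = lam * (B ^+ (m.-1 - j) *m Q) i b + (B ^+ (m.-1 - j).+1 *m Q) i b.
    have -> : (A *m U) i j = (A *m (B ^+ (m.-1 - j) *m Q)) i b.
      by rewrite !mxE; apply: eq_bigr => k _; rewrite !mxE.
    by rewrite {1}AB mulmxDl mul_scalar_mx exprS -mulmxE -mulmxA !mxE.
  rewrite !mxE.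
  under [RHS]eq_bigr => k _ do rewrite !mxE mulrDr.
  rewrite big_split /= (bigD1 j) //= eqxx mulr1n [X in _ + X + _]big1 ?addr0; last first.
    by move=> k ki; rewrite (negPf ki) mulr0n mulr0.
  congr (_ + _).
    by rewrite mulrC.
  case: (posnP j) => [j0|j_gt0].
    rewrite [RHS]big1 => [|k _]; last first.
      by case: eqP => [kj|_]; rewrite ?mulr0 //; rewrite j0 in kj.
    by have /matrixP/(_ i b) := QB0; rewrite comQB j0 subn0 prednK // !mxE.
  have pj : (j.-1 < m)%N by rewrite (leq_ltn_trans (leq_pred j)).
  rewrite [RHS](bigD1 (Ordinal pj)) //= prednK // eqxx mulr1 [X in _ + X]big1 ?addr0; last first.
    move=> k ki; case: eqP => [kj|_]; rewrite ?mulr0 //.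
    by case/eqP: ki; apply/val_inj; rewrite /= -kj.
  by have -> : (m.-1 - j).+1 = (m.-1 - j.-1)%N by have := ltn_ord j; lia.
have VUE i j : (V *m U) i j = (Q *m B ^+ (i + (m.-1 - j)) *m Q) a b.
  rewrite exprD -mulmxE !mulmxA -mulmxA.
  by rewrite !mxE; apply: eq_bigr => k _; rewrite !mxE.
(* Below the diagonal of [V U] the exponent of [B] reaches [m], where [Q B^m = 0]; on the diagonal
   it is [m - 1], which gives the nonzero entry chosen above. So [V U] is triangular and
   invertible. *)
have VUun : V *m U \in unitmx.
  rewrite -unitmx_tr unitmxE det_trig; last first.
    apply/is_trig_mxP => i j ij; rewrite mxE VUE.
    have -> : (j + (m.-1 - i))%N = (m + (j - i).-1)%N by have := ltn_ord i; have := ltn_ord j; lia.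
    by rewrite exprD mulmxA QB0 !mul0mx mxE.
  rewrite unitfE; apply/prodf_neq0 => i _; rewrite mxE VUE.
  by rewrite (_ : (i + (m.-1 - i))%N = m.-1) //; have := ltn_ord i; lia.
(* As [V U] commutes with the Jordan block, replacing [U] by [U (V U)^-1] preserves [A U = U J]. *)
have MJ : V *m U *m jordan_block m lam = jordan_block m lam *m (V *m U).
  by rewrite -mulmxA -AU mulmxA VA mulmxA.
exists m, lam, (U *m invmx (V *m U)), V; split=> //.
  by rewrite mulmxA mulmxV.
rewrite mulmxA AU -!mulmxA; congr (_ *m _).
by rewrite -[LHS](mulKmx VUun) (mulmxA (V *m U)) MJ -mulmxA mulmxV ?mulmx1.
Qed.

(** Strong induction on the size. [Pi = 1 - U V] is a projection that commutes with [A] and kills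
    the block split off. A rank factorisation [Pi = G H] satisfies [H G = 1], so the rest of [A] is
    the smaller matrix [H A G], whose blocks are carried back by [G] and [H]. *)
Lemma jordan_seq_exists n (A : 'M[C]_n) : exists s, jordan_seq A s.
Proof.
elim/ltn_ind: n A => -[|n] IH A.
  by exists [::]; split => //; rewrite ?big_nil; apply/matrixP => -[].
have [m [lam [U [V [m_gt0 VU AU VA]]]]] := jordan_chain_split A.
pose Pi := 1%:M - U *m V.
have [G [H [GH Gfull Hfree]]] : exists (G : 'M[C]_(n.+1, \rank Pi)) (H : 'M[C]_(\rank Pi, n.+1)),
    [/\ G *m H = Pi, row_full G & row_free H].
  by exists (col_base Pi), (row_base Pi); rewrite mulmx_base row_base_free col_base_full.
have Pi2 : Pi *m Pi = Pi.
  rewrite {2}/Pi mulmxBr mulmx1 /Pi mulmxBl mul1mx -!mulmxA (mulmxA V) VU mul1mx.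
  by rewrite subrr subr0.
have HG : H *m G = 1%:M.
  apply: (row_free_inj Hfree); apply: (row_full_inj Gfull) => /=.
  by rewrite mul1mx !mulmxA GH -mulmxA GH Pi2.
have VPi : V *m Pi = 0 by rewrite mulmxBr mulmx1 mulmxA VU mul1mx subrr.
have PiU : Pi *m U = 0 by rewrite mulmxBl mul1mx -mulmxA VU mulmx1 subrr.
have VG : V *m G = 0 by rewrite -[G]mulmx1 -HG (mulmxA G) GH mulmxA VPi mul0mx.
have HU : H *m U = 0 by rewrite -[H]mul1mx -HG -!mulmxA (mulmxA G) GH PiU mulmx0.
have k_lt : (\rank Pi < n.+1)%N.
  rewrite ltn_neqAle rank_leq_row andbT; apply/negP => /eqP rk.
  have Vu : Pi \in unitmx by rewrite -row_free_unit /row_free rk.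
  have V0 : V = 0 by rewrite -[V](mulmxK Vu) VPi mul0mx.
  move/matrixP: VU => /(_ (Ordinal m_gt0) (Ordinal m_gt0)) /eqP.
  by rewrite V0 mul0mx !mxE eqxx eq_sym oner_eq0.
have [s [s_gt0 sRL sRL0 s1 sA]] := IH _ k_lt (H *m A *m G).
pose g (b : jblock (\rank Pi)) := JBlock (jval b) (G *m jleft b) (jright b *m H).
have nthg i : (i < size s)%N ->
    nth (jblock0 n.+1) (map g s) i = g (nth (jblock0 _) s i).
  by move=> i_lt; rewrite (nth_map (jblock0 (\rank Pi))).
exists (JBlock lam U V :: map g s); rewrite /jordan_seq /= size_map; split.
- by case=> [|i] // i_lt; rewrite /= nthg //; apply: s_gt0.
- case=> [|i] // i_lt; rewrite /= nthg //= mulmxA -(mulmxA _ H) HG mulmx1.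
  exact: sRL.
- case=> [|i] [|j] // i_lt j_lt ij; rewrite /= ?nthg //=.
  + by rewrite mulmxA VG mul0mx.
  + by rewrite -mulmxA HU mulmx0.
  by rewrite mulmxA -(mulmxA _ H) HG mulmx1 sRL0.
- rewrite big_cons big_map /=.
  under eq_bigr => b _ do rewrite mulmxA -(mulmxA G).
  by rewrite -mulmx_suml -mulmx_sumr s1 mulmx1 GH addrC subrK.
rewrite big_cons big_map /=.
have -> : \sum_(b <- s) jleft (g b) *m jordan_block (jsize (g b)) (jval (g b)) *m jright (g b)
    = G *m (H *m A *m G) *m H.
  rewrite [in RHS]sA mulmx_sumr mulmx_suml.
  by apply: eq_bigr => b _; rewrite /= !mulmxA.
rewrite !mulmxA GH -(mulmxA _ G) GH -AU.
have APi : A *m Pi = Pi *m A.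
  by rewrite mulmxBr mulmx1 mulmxBl mul1mx mulmxA AU -!mulmxA VA.
by rewrite -APi -(mulmxA A Pi) Pi2 mulmxBr mulmx1 mulmxA addrC subrK.
Qed.

End Jordan.

Section JordanDecomposition.
Variable R : realType.
Local Notation C := R[i].

(** The inverse of [u - N] for the nilpotent shift [N], that is, the finite series of the
    [u^-(l+1) N^l]. *)
Definition jordan_resolvent (s : nat) (u : C) : 'M[C]_s :=
  \matrix_(a, b) (if (a <= b)%N then u ^- (b - a).+1 else 0).

Lemma jordan_resolventP s (z lam : C) : z != lam ->
  (z%:M - jordan_block s lam) *m jordan_resolvent s (z - lam) = 1%:M.
Proof.
move=> zlam; have u0 : z - lam != 0 by rewrite subr_eq0.
apply/matrixP => a b; rewrite !mxE.
under eq_bigr => c _ do rewrite !mxE opprD addrA -mulrnBl mulrBl.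
rewrite big_split /= (bigD1 a) //= eqxx mulr1n [X in _ + X + _]big1 ?addr0; last first.
  by move=> c ca; rewrite eq_sym (negPf ca) mulr0n mul0r.
rewrite sumrN.
have -> : \sum_(c < s) (a.+1 == c)%:R * (if (c <= b)%N then (z - lam) ^- (b - c).+1 else 0)
  = if (a < b)%N then (z - lam) ^- (b - a) else 0.
  case: ltnP => ab.
    rewrite (bigD1 (Ordinal (leq_ltn_trans ab (ltn_ord b)))) //= eqxx mul1r ab subnSK //.
    rewrite big1 ?addr0 // => c ca; case: eqP => [E|_]; last by rewrite mul0r.
    by case/eqP: ca; apply/val_inj.
  rewrite big1 // => c _; case: eqP => [E|_]; last by rewrite mul0r.
  by rewrite -E ltnNge ab mulr0.
case: (ltngtP a b) => ab.
- by rewrite exprS invfM mulVKf // subrr (_ : a == b = false) // -val_eqE /= ltn_eqF.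
- by rewrite mulr0 subr0 -val_eqE /= gtn_eqF.
by rewrite ab subnn subr0 expr1 mulfV // (val_inj ab) eqxx.
Qed.

Variables (n r : nat) (A : 'M[C]_n) (p : 'I_r -> nat) (lam : 'I_r -> C).
Variables (P : 'M[C]_(n, \sum_i p i)) (Q : 'M[C]_(\sum_i p i, n)).
Hypothesis dec : jordan_decomposition A lam P Q.

Lemma mul_mxdiag_sum (X : forall i, 'M[C]_(p i)) :
  P *m (\mxdiag_i X i) *m Q = \sum_i submxrow P i *m X i *m submxcol Q i.
Proof.
by rewrite -{1}(submxrowK P) -{1}(submxcolK Q) mul_mxrow_mxdiag mul_mxrow_mxcol.
Qed.

Lemma jordan_decomposition_sum :
  A = \sum_i submxrow P i *m jordan_block (p i) (lam i) *m submxcol Q i.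
Proof. by case: dec => _ _ _ ->; rewrite mul_mxdiag_sum. Qed.

Lemma jordan_proj_sum : \sum_i submxrow P i *m submxcol Q i = 1%:M.
Proof. by case: dec => _ <- _ _; rewrite -mul_mxrow_mxcol submxrowK submxcolK. Qed.

(** [conform_mx] comes from [\mxdiag]: the sizes [p i] and [p j] agree only through the test
    [i == j]. *)
Lemma jordan_proj_orth i j :
  submxcol Q i *m submxrow P j = if i == j then conform_mx 0 (1%:M : 'M[C]_(p i)) else 0.
Proof.
have [_ _ QP _] := dec.
have -> : submxcol Q i *m submxrow P j = submxblock (Q *m P) i j.
  by rewrite submxblockEh submxcol_mul -mul_submxrow.
by rewrite QP -(mxdiagZ 1) mxblockK.
Qed.

(** [eigenvalue] is about row vectors: the last row of the [i]-th block of [Q] is an eigenvector,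
    because the last row of a Jordan block has only its diagonal entry. *)
Lemma jordan_eigenvalue i : eigenvalue A (lam i).
Proof.
have [p_gt0 _ _ _] := dec.
have pp : ((p i).-1 < p i)%N by rewrite ltn_predL.
apply/eigenvalueP; exists (row (Ordinal pp) (submxcol Q i)).
  rewrite -row_mul {1}jordan_decomposition_sum mulmx_sumr (bigD1 i) //= big1 => [|j ji].
    rewrite addr0 !mulmxA jordan_proj_orth eqxx conform_mx_id mul1mx row_mul.
    have -> : row (Ordinal pp) (jordan_block (p i) (lam i)) = lam i *: delta_mx 0 (Ordinal pp).
      apply/rowP => c; rewrite !mxE eqxx /= prednK // eq_sym.
      case: (_ =P _ :> 'I_(p i)) => _; rewrite ?mulr1 ?mulr0 [(p i == c)](_ : _ = false) ?addr0 //;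
        by apply/negbTE; rewrite neq_ltn ltn_ord orbT.
    by rewrite -scalemxAl -rowE.
  by rewrite !mulmxA jordan_proj_orth eq_sym (negPf ji) !mul0mx.
apply/eqP => /(congr1 (mulmx^~ (submxrow P i))) /=.
rewrite -row_mul jordan_proj_orth eqxx conform_mx_id mul0mx => /rowP/(_ (Ordinal pp)).
by rewrite !mxE eqxx => /eqP; rewrite oner_eq0.
Qed.

Lemma jordan_resolvent_sum z : (forall i, z != lam i) ->
  (z%:M - A) *m
  (\sum_i submxrow P i *m jordan_resolvent (p i) (z - lam i) *m submxcol Q i) = 1%:M.
Proof.
move=> zlam; rewrite mulmx_sumr -jordan_proj_sum; apply: eq_bigr => i _.
have -> : z%:M - A = \sum_i submxrow P i *m (z%:M - jordan_block (p i) (lam i)) *m submxcol Q i.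
  under eq_bigr => j _ do rewrite mulmxBr mulmxBl mul_mx_scalar -scalemxAl.
  by rewrite big_split /= sumrN -scaler_sumr jordan_proj_sum scalemx1 -jordan_decomposition_sum.
rewrite mulmx_suml (bigD1 i) //= big1 => [|j ji].
  rewrite addr0 -!mulmxA (mulmxA (submxcol Q i)) jordan_proj_orth eqxx conform_mx_id mul1mx.
  by rewrite (mulmxA (_ - _)) jordan_resolventP // mul1mx.
by rewrite -!mulmxA (mulmxA (submxcol Q j)) jordan_proj_orth (negPf ji) !mul0mx !mulmx0.
Qed.

End JordanDecomposition.

Section MatfunSpec.
Variable R : realType.
Local Notation C := R[i].

Lemma jordan_decomposition_exists n (A : 'M[C]_n) :
  exists (r : nat) (p : 'I_r -> nat) (lam : 'I_r -> C)
    (P : 'M[C]_(n, \sum_i p i)) (Q : 'M[C]_(\sum_i p i, n)),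
    jordan_decomposition A lam P Q.
Proof.
have [s [s_gt0 sRL sRL0 s1 sA]] := jordan_seq_exists A.
pose b (i : 'I_(size s)) := nth (jblock0 R n) s i.
exists (size s), (fun i => jsize (b i)), (fun i => jval (b i)).
exists (\mxrow_i jleft (b i)), (\mxcol_i jright (b i)); split.
- by move=> i; apply: s_gt0.
- by rewrite mul_mxrow_mxcol -s1 (big_nth (jblock0 R n)) big_mkord.
- rewrite mul_mxcol_mxrow -(mxdiagZ 1); apply: eq_mxblock => i j.
  case: eqVneq => [<-|ij]; first by rewrite conform_mx_id sRL.
  by rewrite sRL0.
rewrite mul_mxrow_mxdiag mul_mxrow_mxcol [LHS]sA (big_nth (jblock0 R n)) big_mkord.
by [].
Qed.

Lemma matfun_spec_matfun f n (A : 'M[C]_n) : matfun_spec f A (matfun f A).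
Proof.
have [r [p [lam [P [Q dec]]]]] := jordan_decomposition_exists A.
rewrite /matfun; case: xgetP => [B -> //|].
move=> /(_ (P *m (\mxdiag_i fun_jordan_block f (p i) (lam i)) *m Q)) [].
by exists r, p, lam, P, Q.
Qed.

End MatfunSpec.

(** * Complex limits and derivatives *)

Section ComplexEpsilonDelta.
Variable R : realType.
Local Notation C := R[i].
Local Notation normc := (@ComplexField.Normc.normc R).

(** The norm of [R[i]] takes its values in [R[i]]. Estimates use the real-valued [normc] instead, so
    that they are inequalities in an ordered field. *)
Lemma normrE (z : C) : `|z| = (normc z)%:C. Proof. by []. Qed.

Lemma normc_ge0 (z : C) : 0 <= normc z.
Proof. by rewrite -lecR -normrE normr_ge0. Qed.

Lemma normcD (x y : C) : normc (x + y) <= normc x + normc y.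
Proof. by rewrite -lecR rmorphD /= -!normrE ler_normD. Qed.

Lemma normcN (x : C) : normc (- x) = normc x.
Proof. by apply: complexI; rewrite -!normrE normrN. Qed.

Lemma normcB (x y : C) : normc (x - y) <= normc x + normc y.
Proof. by rewrite (le_trans (normcD _ _)) // normcN. Qed.

Lemma normc_distC (x y : C) : normc (x - y) = normc (y - x).
Proof. by rewrite -normcN opprB. Qed.

Lemma normc_triangle (y x z : C) : normc (x - z) <= normc (x - y) + normc (y - z).
Proof. by rewrite -[x - z](subrKA y) normcD. Qed.

Lemma normcM (x y : C) : normc (x * y) = normc x * normc y.
Proof. by apply: complexI; rewrite rmorphM /= -!normrE normrM. Qed.

Lemma normcV (x : C) : normc x^-1 = (normc x)^-1.
Proof. by apply: complexI; rewrite fmorphV /= -!normrE normfV. Qed.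

Lemma normcX (x : C) k : normc (x ^+ k) = normc x ^+ k.
Proof. by apply: complexI; rewrite rmorphXn /= -!normrE normrX. Qed.

Lemma normc_gt0 (x : C) : (0 < normc x) = (x != 0).
Proof. by rewrite -ltcR -normrE normr_gt0. Qed.

Lemma normc0 : normc 0 = 0.
Proof. by apply: complexI; rewrite -normrE normr0. Qed.

Lemma normc1 : normc 1 = 1.
Proof. by apply: complexI; rewrite -normrE normr1. Qed.

Lemma normc_real (x : R) : 0 <= x -> normc x%:C = x.
Proof. by move=> x0; apply: complexI; rewrite -normrE ger0_norm // ler0c. Qed.

Lemma normc_nat k : normc k%:R = k%:R.
Proof. by rewrite -[k%:R in LHS](rmorph_nat (real_complex R)) normc_real // ler0n. Qed.

Lemma normc_sum (I : Type) (r : seq I) (P : pred I) (F : I -> C) :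
  normc (\sum_(i <- r | P i) F i) <= \sum_(i <- r | P i) normc (F i).
Proof.
elim/big_rec2: _ => [|i x y _ h]; first by rewrite normc0.
by rewrite (le_trans (normcD _ _)) // lerD2l.
Qed.

Lemma normRe_le (z : C) : `|complex.Re z| <= normc z.
Proof. by rewrite -lecR -normrE; exact: normc_ge_Re. Qed.

Lemma normIm_le (z : C) : `|complex.Im z| <= normc z.
Proof.
have := normRe_le (z * 'i%C); rewrite ReiNIm normrN normcM.
by rewrite [X in _ * X](_ : _ = 1) ?mulr1 //= expr0n /= expr1n add0r sqrtr1.
Qed.

Lemma normc_le_ReIm (z : C) : normc z <= `|complex.Re z| + `|complex.Im z|.
Proof.
case: z => a b.
rewrite -[a +i* b]/(Complex a b) [X in normc X](_ : _ = a%:C + 'i%C * b%:C); last first.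
  exact: complexE.
rewrite (le_trans (normcD _ _)) // normcM.
rewrite [X in _ + X * _](_ : _ = 1) ?mul1r; last by rewrite /= expr0n /= expr1n add0r sqrtr1.
by rewrite /= !expr0n /= !addr0 !sqrtr_sqr.
Qed.

Lemma nbhs_normc (x : R[i]^o) (P : R[i]^o -> Prop) :
  (\forall y \near x, P y) <->
  exists2 e : R, 0 < e & forall y, normc (y - x) < e -> P y.
Proof.
split=> [/nbhs_normP[e /= e0 he]|[e e0 he]].
  have [k ek] : exists k : R, e = k%:C by apply/complex_realP/gtr0_real.
  exists k; first by rewrite -ltcR -ek.
  by move=> y yx; apply: he; rewrite /= distrC normrE ek ltcR.
apply/nbhs_normP; exists e%:C; first by rewrite /= ltcR.
by move=> y /=; rewrite distrC normrE ltcR => /he.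
Qed.

Lemma cvg_normcP {T : Type} {F : set_system T} {FF : Filter F} (g : T -> R[i]^o) (l : R[i]^o) :
  g @ F --> l <-> forall e : R, 0 < e -> \forall t \near F, normc (g t - l) <= e.
Proof.
split=> [/cvgrPdist_le h e e0|h].
  have := h e%:C; rewrite ltcR => /(_ e0); apply: filterS => t.
  by rewrite distrC normrE lecR.
apply/cvgrPdist_le => e e0.
have [k ek] : exists k : R, e = k%:C by apply/complex_realP/gtr0_real.
have k0 : 0 < k by rewrite -ltcR -ek.
by apply: filterS (h k k0) => t; rewrite distrC normrE ek lecR.
Qed.

Lemma cvg_normcMl {T : Type} {F : set_system T} {FF : Filter F} (g : T -> C) (l k : C) :
  (g : T -> R[i]^o) @ F --> (l : R[i]^o) ->
  (fun t => k * g t : R[i]^o) @ F --> (k * l : R[i]^o).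
Proof.
move=> /cvg_normcP h; apply/cvg_normcP => e e0.
have k1 : 0 < normc k + 1 by rewrite ltr_wpDl // normc_ge0.
apply: filterS (h (e / (normc k + 1)) (divr_gt0 e0 k1)) => t.
rewrite -mulrBr normcM ler_pdivlMr // => ht; apply: le_trans ht.
by rewrite mulrC ler_wpM2l ?normc_ge0 // lerDl.
Qed.

Lemma cvg_normc_sum {T : Type} {F : set_system T} {FF : Filter F} (I : Type) (s : seq I)
    (g : I -> T -> C) (l : I -> C) :
  (forall i, (g i : T -> R[i]^o) @ F --> (l i : R[i]^o)) ->
  (fun t => \sum_(i <- s) g i t : R[i]^o) @ F --> (\sum_(i <- s) l i : R[i]^o).
Proof.
move=> h; apply/cvg_normcP; elim: s => [|i s IH] e e0.
  by apply: nearW => t; rewrite !big_nil subrr normc0 ltW.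
have e20 : 0 < e / 2 by rewrite divr_gt0.
move/cvg_normcP/(_ _ e20): (h i) => hi; apply: filterS2 hi (IH _ e20) => t h1 h2.
rewrite !big_cons opprD addrACA; apply: le_trans (normcD _ _) _.
by rewrite [e]splitr lerD.
Qed.

Lemma cvg_normc_le {T : Type} {F : set_system T} {FF : ProperFilter F}
    (g : T -> C) (l : C) (B : R) :
  (g : T -> R[i]^o) @ F --> (l : R[i]^o) -> (\forall t \near F, normc (g t) <= B) -> normc l <= B.
Proof.
move=> /cvg_normcP h hB; apply/ler_addgt0Pr => e e0.
have [t [h1 h2]] := filter_ex (filterI (h e e0) hB).
rewrite -(subrK (g t) l); apply: le_trans (normcD _ _) _.
by rewrite addrC lerD // normc_distC.
Qed.

Lemma cvg_normc_unique {T : Type} {F : set_system T} {FF : ProperFilter F}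
    (g : T -> C) (l1 l2 : C) :
  (g : T -> R[i]^o) @ F --> (l1 : R[i]^o) -> (g : T -> R[i]^o) @ F --> (l2 : R[i]^o) -> l1 = l2.
Proof. by move=> h1 h2; apply: cvg_unique h1 h2; exact: norm_hausdorff. Qed.

(** The derivative in product form: there is no quotient, hence no punctured neighborhood, and the
    increment [0] is allowed. *)
Definition cderiv (f : C -> C) (z d : C) : Prop :=
  forall e : R, 0 < e -> exists2 del : R, 0 < del &
    forall h, normc h < del -> normc (f (z + h) - f z - d * h) <= e * normc h.

Lemma cderivP (f : R[i]^o -> R[i]^o) (z d : R[i]^o) : is_derive z 1 f d <-> cderiv f z d.
Proof.
have E h : h != 0 :> C -> normc (h^-1 *: (f (h *: 1 + z) - f z) - d) =
    normc (f (z + h) - f z - d * h) / normc h.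
  move=> h0; rewrite -normcV -normcM mulrBl mulfK //; congr (normc (_ - _)).
  by rewrite -[LHS]/(h^-1 * (f (h * 1 + z) - f z)) mulr1 mulrC (addrC h).
have H : ((fun h : R[i]^o => (h : R[i])^-1 *: (f (h *: (1 : R[i]^o) + z) - f z))
    @ (0 : R[i]^o)^' --> d) <-> cderiv f z d.
  rewrite cvg_normcP; split=> h e e0; have := h e e0.
    move=> /nbhs_normc[del del0 hd]; exists del => // u udel.
    case: (eqVneq u 0) => [->|u0].
      by rewrite addr0 mulr0 subr0 subrr normc0 mulr0.
    have := hd u; rewrite subr0 => /(_ udel u0).
    by rewrite E // ler_pdivrMr // normc_gt0.
  move=> [del del0 hd]; apply/nbhs_normc; exists del => // u.
  by rewrite subr0 => /hd hu u0; rewrite E // ler_pdivrMr // normc_gt0.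
split=> [[df dfd]|/H h].
  by apply/H; rewrite -dfd; exact: df.
have df : derivable f z 1 by apply/cvg_ex; exists d.
by split => //; exact: cvg_lim h.
Qed.

Lemma cderiv_derive1 (f : R[i]^o -> R[i]^o) (z d : C) : cderiv f z d -> derive1 f z = d.
Proof. by move/cderivP => h; rewrite derive1E derive_val. Qed.

(** The approximate limit [d] may depend on [e]; below it is a difference quotient. Real and
    imaginary parts are 1-Lipschitz, so completeness of [R] applies to each. *)
Lemma cauchy_complex (a : nat -> C) :
  (forall e : R, 0 < e -> exists d : C, \forall k \near \oo, normc (a k - d) <= e) ->
  exists l : C, a @ \oo --> (l : R[i]^o).
Proof.
move=> ha.
have key (g : C -> R) : (forall x y, `|g x - g y| <= normc (x - y)) ->
    cvgn (g \o a).
  move=> hg; apply/cauchy_cvgP/cauchy_exP => e e0.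
  have [d hd] := ha (e / 2) (divr_gt0 e0 (ltr0n _ 2)).
  exists (g d); apply: filterS hd => k hk; rewrite /ball /= distrC.
  apply: le_lt_trans (hg _ _) _; apply: le_lt_trans hk _.
  by rewrite ltr_pdivrMr // ltr_pMr // ltr1n.
have /cvg_ex[x hx] : cvgn ((@complex.Re R) \o a).
  by apply: key => -[x1 x2] [y1 y2]; exact: (normRe_le (Complex (x1 - y1) (x2 - y2))).
have /cvg_ex[y hy] : cvgn ((@complex.Im R) \o a).
  by apply: key => -[x1 x2] [y1 y2]; exact: (normIm_le (Complex (x1 - y1) (x2 - y2))).
exists (x +i* y); apply/cvg_normcP => e e0.
have e20 : 0 < e / 2 by rewrite divr_gt0.
move/cvgrPdist_le/(_ _ e20): hx => hx; move/cvgrPdist_le/(_ _ e20): hy => hy.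
near=> k.
apply: le_trans (normc_le_ReIm _) _.
rewrite [e]splitr lerD //.
- have : `|x - complex.Re (a k)| <= e / 2 by near: k.
  by rewrite distrC; case: (a k).
- have : `|y - complex.Im (a k)| <= e / 2 by near: k.
  by rewrite distrC; case: (a k).
Unshelve. all: by end_near. Qed.

End ComplexEpsilonDelta.

#[local] Arguments ComplexField.Normc.normc : simpl never.

(** * Mean value inequality and uniform continuity on a disc *)

Section MeanValue.
Variable R : realType.
Local Notation C := R[i].
Local Notation normc := (@ComplexField.Normc.normc R).

Lemma cderiv_affine (f : C -> C) (a b t d : C) :
  cderiv f (a + t * b) d -> cderiv (fun s => f (a + s * b)) t (d * b).
Proof.
move=> fd e e0.
have b1 : 0 < normc b + 1 by rewrite ltr_wpDl // normc_ge0.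
have [del del0 h] := fd (e / (normc b + 1)) (divr_gt0 e0 b1).
exists (del / (normc b + 1)); first by rewrite divr_gt0.
move=> u; rewrite ltr_pdivlMr // => udel.
have ub : normc (u * b) <= normc u * (normc b + 1).
  by rewrite normcM ler_wpM2l ?normc_ge0 // lerDl.
rewrite mulrDl addrA -mulrA (mulrC b); apply: le_trans (h _ (le_lt_trans ub udel)) _.
rewrite mulrAC ler_pdivrMr // -mulrA; apply: ler_wpM2l => //; exact: ltW.
Qed.

Lemma cderivMr (f : C -> C) (z d k : C) : cderiv f z d -> cderiv (fun y => f y * k) z (d * k).
Proof.
move=> fd e e0.
have k1 : 0 < normc k + 1 by rewrite ltr_wpDl // normc_ge0.
have [del del0 h] := fd (e / (normc k + 1)) (divr_gt0 e0 k1).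
exists del => // u /h hu; rewrite -mulrBl mulrAC -mulrBl normcM.
have := normc_ge0 k => k0.
apply: le_trans (ler_wpM2r k0 hu) _.
rewrite mulrAC ler_wpM2r ?normc_ge0 // mulrAC ler_pdivrMr // ler_wpM2l ?lerDl //; exact: ltW.
Qed.

Lemma cderivD (f g : C -> C) (z df dg : C) :
  cderiv f z df -> cderiv g z dg -> cderiv (fun y => f y + g y) z (df + dg).
Proof.
move=> fd gd e e0; have e20 : 0 < e / 2 by rewrite divr_gt0.
have [d1 d10 h1] := fd _ e20; have [d2 d20 h2] := gd _ e20.
exists (Num.min d1 d2); first by rewrite lt_min d10.
move=> u; rewrite lt_min => /andP[/h1 u1 /h2 u2].
rewrite (_ : _ - _ - _ = (f (z + u) - f z - df * u) + (g (z + u) - g z - dg * u)); last by ring.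
by apply: le_trans (normcD _ _) _; rewrite [e]splitr mulrDl lerD.
Qed.

Lemma cderiv_cst (k z : C) : cderiv (fun => k) z 0.
Proof.
move=> e e0; exists 1 => // u _; rewrite subrr mul0r subr0 normc0.
by rewrite mulr_ge0 ?normc_ge0 // ltW.
Qed.

Lemma cderiv_sum (I : Type) (s : seq I) (F : I -> C -> C) (z : C) (D : I -> C) :
  (forall i, cderiv (F i) z (D i)) ->
  cderiv (fun y => \sum_(i <- s) F i y) z (\sum_(i <- s) D i).
Proof.
move=> h; elim: s => [|i s IH].
  have -> : (fun y => \sum_(i <- [::]) F i y) = (fun => 0) by apply/funext => y; rewrite big_nil.
  by rewrite big_nil; exact: cderiv_cst.
have -> : (fun y => \sum_(i <- i :: s) F i y) = (fun y => F i y + \sum_(i <- s) F i y).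
  by apply/funext => y; rewrite big_cons.
by rewrite big_cons; apply: cderivD.
Qed.

(** The mean value equality fails for complex values, so the inequality is proved by a supremum
    argument with slope [M + e]: the bound passes to the supremum of the [s] for which it holds, and
    the derivative there extends it further unless that supremum is [1]. *)
Lemma unit_segment_mean_value (F D : C -> C) (M : R) :
  (forall s : R, 0 <= s <= 1 -> cderiv F s%:C (D s%:C)) ->
  (forall s : R, 0 <= s <= 1 -> normc (D s%:C) <= M) ->
  normc (F 1 - F 0) <= M.
Proof.
move=> FD DM; apply/ler_addgt0Pr => e e0.
have step s : 0 <= s <= 1 -> exists2 del : R, 0 < del & forall t, `|t - s| < del ->
    normc (F t%:C - F s%:C) <= (M + e) * `|t - s|.
  move=> s01; have [del del0 h] := FD s s01 e e0.
  exists del => // t ts; have nts : normc (t - s)%:C = `|t - s|.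
    by apply: complexI; rewrite -normrE normc_def /= expr0n addr0 sqrtr_sqr.
  have := h (t - s)%:C; rewrite nts => /(_ ts).
  have -> : s%:C + (t - s)%:C = t%:C by rewrite -rmorphD /= addrC subrK.
  move=> ht.
  rewrite -[F t%:C - _](subrK (D s%:C * (t - s)%:C)).
  apply: le_trans (normcD _ _) _; rewrite normcM nts mulrDl addrC lerD //.
  by rewrite ler_wpM2r // DM.
have M0 : 0 <= M by apply: le_trans (normc_ge0 _) (DM 0 _); rewrite lexx ler01.
have Me : 0 < M + e by rewrite ltr_wpDl.
pose S := [set s : R | 0 <= s <= 1 /\ normc (F s%:C - F 0) <= (M + e) * s].
have S0 : S 0 by split; rewrite ?lexx ?ler01 // subrr normc0 mulr0.
have Ssup : has_sup S by split; [exists 0|exists 1 => s [/andP[]]].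
set sig := sup S.
have sig01 : 0 <= sig <= 1.
  apply/andP; split; first by apply: ub_le_sup => //; case: Ssup.
  by apply: ge_sup; [exists 0|move=> s [/andP[]]].
have [del del0 h] := step sig sig01.
have Ssig : S sig.
  split=> //; have [s Ss sdel] := sup_adherent del0 Ssup.
  have ssig : s <= sig by apply: ub_le_sup => //; case: Ssup.
  have ds : `|s - sig| < del by rewrite distrC ger0_norm ?subr_ge0 // ltrBlDr -ltrBlDl.
  have := h s ds; rewrite normc_distC distrC ger0_norm ?subr_ge0 // => hs.
  rewrite -(subrK (F s%:C) (F sig%:C)) -addrA.
  apply: le_trans (normcD _ _) _; case: Ss => _ Ss.
  by apply: le_trans (lerD hs Ss) _; rewrite -mulrDr subrK.
case: (ltP sig 1) => sig1; last first.
  have E : sig = 1 by apply/eqP; rewrite eq_le sig1; case/andP: sig01 => _ ->.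
  by case: Ssig; rewrite E mulr1.
pose t := Num.min 1 (sig + del / 2).
have sigt : sig < t by rewrite lt_min sig1 ltrDl divr_gt0.
have St : S t.
  split; first by rewrite ge_min lexx andbT (le_trans _ (ltW sigt)) //; case/andP: sig01.
  have dt : `|t - sig| < del.
    rewrite gtr0_norm ?subr_gt0 // ltrBlDl gt_min; apply/orP; right.
    by rewrite ltrD2l ltr_pdivrMr // ltr_pMr // ltr1n.
  have := h t dt; rewrite gtr0_norm ?subr_gt0 // => ht.
  rewrite -(subrK (F sig%:C) (F t%:C)) -addrA.
  apply: le_trans (normcD _ _) _; case: Ssig => _ Ss.
  by apply: le_trans (lerD ht Ss) _; rewrite -mulrDr subrK.
have : t <= sig by apply: ub_le_sup => //; case: Ssup.
by rewrite leNgt sigt.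
Qed.

(** The mean value inequality for [f] minus the linear map of slope [L]; with [L] the derivative at
    [x], it is a first-order Taylor estimate. *)
Lemma segment_mean_value (f f' : C -> C) (x y L : C) (e : R) :
  (forall s : R, 0 <= s <= 1 ->
     cderiv f (x + s%:C * (y - x)) (f' (x + s%:C * (y - x))) /\
     normc (f' (x + s%:C * (y - x)) - L) <= e) ->
  normc (f y - f x - L * (y - x)) <= e * normc (y - x).
Proof.
move=> h.
pose F t := f (x + t * (y - x)) + (- t) * (L * (y - x)).
have -> : f y - f x - L * (y - x) = F 1 - F 0.
  by rewrite /F mul1r mul0r addr0 oppr0 mul0r addr0 (addrC x) subrK; ring.
apply: (@unit_segment_mean_value F
  (fun t => f' (x + t * (y - x)) * (y - x) + (-1) * (L * (y - x)))).
  move=> s /h[fd _]; apply: cderivD; first exact: cderiv_affine.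
  apply: (@cderivMr (fun t => - t)) => eps eps0; exists 1 => // u _.
  rewrite (_ : _ - _ - _ = 0); last by ring.
  by rewrite normc0 mulr_ge0 ?normc_ge0 // ltW.
move=> s /h[_ hs]; rewrite mulrA mulN1r -mulrDl normcM.
by rewrite ler_wpM2r ?normc_ge0.
Qed.

(** Heine-Cantor. Compactness is that of the square in [R * R] around the disc, a product of
    segments; the property [P] is vacuous off the disc. *)
Lemma disc_uniform_continuity (g : R[i]^o -> R[i]^o) (c : C) (r : R) :
  (forall z, normc (z - c) <= r -> {for z, continuous g}) ->
  forall e : R, 0 < e -> exists2 del : R, 0 < del &
    forall x y, normc (x - c) <= r -> normc (y - c) <= r -> normc (y - x) < del ->
      normc (g y - g x) <= e.
Proof.
move=> gc e e0.
pose K : set (R * R) := `[complex.Re c - r, complex.Re c + r]%classic `*`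
  `[complex.Im c - r, complex.Im c + r]%classic.
have Kc : compact K by apply: compact_setX; exact: segment_compact.
pose P (del : R) (p : R * R) := normc (p.1 +i* p.2 - c) <= r ->
  forall y, normc (y - c) <= r -> normc (y - (p.1 +i* p.2)) < del ->
  normc (g y - g (p.1 +i* p.2)) <= e.
have : \forall del \near 0^'+, K `<=` P del.
  move/compact_near_coveringP : Kc; apply => -[a b] _ /=.
  have near_ab d : 0 < d -> \forall p \near (a, b), normc (p.1 +i* p.2 - (a +i* b)) < d.
    move=> d0; have d20 : 0 < d / 2 by rewrite divr_gt0.
    exists (ball a (d / 2), ball b (d / 2)); first by split; exact: nbhsx_ballx.
    move=> [p1 p2] /= []; rewrite /ball /= => h1 h2.
    change (normc ((p1 - a) +i* (p2 - b)) < d).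
    apply: le_lt_trans (normc_le_ReIm _) _ => /=.
    by rewrite [d]splitr ltrD // distrC.
  (* A point of the square outside the closed disc has a whole neighborhood outside it, where [P] is
     vacuous. *)
  case: (leP (normc (a +i* b - c)) r) => abr; last first.
    have d0 : 0 < normc (a +i* b - c) - r by rewrite subr_gt0.
    exists ([set p | normc (p.1 +i* p.2 - (a +i* b)) < normc (a +i* b - c) - r], setT).
      by split; [exact: near_ab|exact: filterT].
    move=> [p del] /= [hp _] /= hr; exfalso.
    have := normcD (p.1 +i* p.2 - c) (a +i* b - (p.1 +i* p.2)).
    rewrite addrC subrKA [X in _ <= _ + X]normc_distC; lra.
  have e20 : 0 < e / 2 by rewrite divr_gt0.
  have /cvg_normcP h := gc _ abr; have /nbhs_normc[d0 d00 hd0] := h _ e20.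
  have d020 : 0 < d0 / 2 by rewrite divr_gt0.
  exists ([set p | normc (p.1 +i* p.2 - (a +i* b)) < d0 / 2], [set del | del < d0 / 2]).
    by split; [exact: near_ab|exact: nbhs_right_lt].
  move=> [p del] /= [hp hdel] /= _ y _ hy.
  have h1 : normc (g (p.1 +i* p.2) - g (a +i* b)) <= e / 2 by apply: hd0; lra.
  have h2 : normc (g y - g (a +i* b)) <= e / 2.
    apply: hd0; rewrite -(subrK (p.1 +i* p.2) y) -addrA.
    by apply: le_lt_trans (normcD _ _) _; lra.
  rewrite -(subrKA (g (a +i* b))); apply: le_trans (normcD _ _) _.
  by rewrite [X in _ + X]normc_distC; lra.
move=> h; have [del [del0 hd]] : exists del : R, 0 < del /\ K `<=` P del.
  by have := filter_ex (filterI (nbhs_right_gt (0 : R)) h) => -[del []]; exists del.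
exists del => // -[a b] y xr yr yx; apply: (hd (a, b)) => //.
have := normRe_le (a +i* b - c); have := normIm_le (a +i* b - c).
have [-> ->] : complex.Re (a +i* b - c) = a - complex.Re c /\
    complex.Im (a +i* b - c) = b - complex.Im c by case: (c).
rewrite !ler_distl /= in xr * => /andP[h1 h2] /andP[h3 h4].
by split; rewrite /= in_itv /=; apply/andP; split; lra.
Qed.

End MeanValue.

(** * Cauchy's formula as a limit of means over roots of unity *)

Section CauchyFormula.
Variable R : realType.
Local Notation C := R[i].
Local Notation normc := (@ComplexField.Normc.normc R).

(* unity_root k has order 2 ^ k.+1 and tends to 1: each one is the square root
   of the previous one in the right half-plane. *)
Fixpoint unity_root (k : nat) : C :=
  if k is k'.+1 then sqrtc (unity_root k') else -1.

Lemma unity_rootS k : unity_root k.+1 ^+ 2 = unity_root k.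
Proof. exact: sqr_sqrtc. Qed.

Lemma unity_root_expN1 k : unity_root k ^+ (2 ^ k) = -1.
Proof.
elim: k => [|k IH]; first by rewrite expr1.
by rewrite expnS exprM unity_rootS.
Qed.

Lemma unity_root_exp k : unity_root k ^+ (2 ^ k.+1) = 1.
Proof. by rewrite expnSr exprM unity_root_expN1 sqrrN expr1n. Qed.

Lemma unity_root_prim k : (2 ^ k.+1).-primitive_root (unity_root k).
Proof.
have [|m prim mdv] := prim_order_exists _ (unity_root_exp k); first by rewrite expn_gt0.
have [i ik mE] := dvdn_pfactor m k.+1 (isT : prime 2) mdv.
move: ik; rewrite leq_eqVlt => /orP[/eqP iE|ik]; first by rewrite -iE -mE.
have : unity_root k ^+ (2 ^ k) = 1.
  apply/eqP; rewrite -(prim_order_dvd prim) mE; exact: dvdn_exp2l.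
by rewrite unity_root_expN1 => /eqP; rewrite eq_sym -subr_eq0 opprK -[1 + 1]/(2%:R) pnatr_eq0.
Qed.

Lemma normc_unity_root k : normc (unity_root k) = 1.
Proof.
have : normc (unity_root k) ^+ (2 ^ k.+1) = 1 by rewrite -normcX unity_root_exp normc1.
move/eqP; rewrite -[X in _ == X](expr1n _ (2 ^ k.+1)).
by rewrite eqrXn2 ?expn_gt0 ?normc_ge0 // => /eqP.
Qed.

(** From [w^2 - 1 = (w - 1) (w + 1)], where [|w| = 1] and [Re w >= 0] give
    [|w + 1| >= sqrt 2 >= 4 / 3]: each square root shrinks the distance to 1 by [3 / 4] at least.
    The factor [2] is the distance from [-1] to [1]. *)
Lemma unity_root_dist k : normc (unity_root k - 1) <= 2 * (3 / 4) ^+ k.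
Proof.
elim: k => [|k IH].
  rewrite expr0 mulr1; apply: le_trans (normcB _ _) _.
  by rewrite normcN normc1.
have Re0 : 0 <= complex.Re (unity_root k.+1).
  by rewrite /=; case: (unity_root k) => a b /=; rewrite sqrtr_ge0.
have e : unity_root k - 1 = (unity_root k.+1 - 1) * (unity_root k.+1 + 1).
  by rewrite -unity_rootS; ring.
have big : 4 / 3 <= normc (unity_root k.+1 + 1).
  have n1 := normc_unity_root k.+1.
  move: Re0 n1; set w := unity_root k.+1; clearbody w; case: w => a b /= a0 n1.
  have n2 : a ^+ 2 + b ^+ 2 = 1.
    by rewrite -[LHS]sqr_sqrtr ?addr_ge0 ?sqr_ge0 // [X in X ^+ 2]n1 expr1n.
  rewrite -[4 / 3]ger0_norm // -sqrtr_sqr /ComplexField.Normc.normc /= addr0.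
  rewrite ler_wsqrtr //; nra.
rewrite e normcM in IH.
rewrite exprSr mulrA.
have := le_trans (ler_wpM2l (normc_ge0 (unity_root k.+1 - 1)) big) IH; lra.
Qed.

Lemma unity_root_cvg (d : R) : 0 < d ->
  \forall k \near \oo, normc (unity_root k - 1) < d.
Proof.
move=> d0; have d40 : 0 < d / 4 by rewrite divr_gt0.
have h : (fun k => (3 / 4 : R) ^+ k) @ \oo --> (0 : R).
  apply: cvg_expr; rewrite ger0_norm; lra.
move/cvgrPdist_le/(_ _ d40): h; apply: filterS => k.
rewrite sub0r normrN ger0_norm ?exprn_ge0 // => hk.
apply: le_lt_trans (unity_root_dist k) _; lra.
Qed.

Definition circle_point (c : C) (r : R) (k j : nat) : C := c + r%:C * unity_root k ^+ j.

(** Discretises the integral of [g z / (z - c)] over the circle divided by [2 i pi]; hence the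
    factor [z - c] in the kernels below. *)
Definition circle_mean (k : nat) (c : C) (r : R) (g : C -> C) : C :=
  (2 ^ k.+1)%:R^-1 * \sum_(j < 2 ^ k.+1) g (circle_point c r k j).

Lemma circle_pointB c r k j : circle_point c r k j - c = r%:C * unity_root k ^+ j.
Proof. by rewrite /circle_point addrC addKr. Qed.

Lemma normc_circle_point c (r : R) k j : 0 <= r -> normc (circle_point c r k j - c) = r.
Proof.
by move=> r0; rewrite circle_pointB normcM normcX normc_unity_root expr1n mulr1 normc_real.
Qed.

Lemma convex_disc (c w z : C) (r s : R) : 0 <= s <= 1 ->
  normc (w - c) <= r -> normc (z - c) <= r -> normc (w + s%:C * (z - w) - c) <= r.
Proof.
move=> /andP[s0 s1] wr zr.
have -> : w + s%:C * (z - w) - c = (1 - s)%:C * (w - c) + s%:C * (z - c).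
  by rewrite rmorphB /= rmorph1; ring.
apply: le_trans (normcD _ _) _; rewrite !normcM !normc_real ?subr_ge0 //.
by have := normc_ge0 (w - c); nra.
Qed.

Section Disc.
Variables (f f' : R[i]^o -> R[i]^o) (c : C) (r : R).
Hypothesis r_gt0 : 0 < r.
Hypothesis fD : forall z, normc (z - c) <= r -> cderiv f z (f' z).
Hypothesis f'C : forall z, normc (z - c) <= r -> {for z, continuous f'}.

(* The points z_j = circle_point c r k j are contracted to w along
   p_j(t) = w + t (z_j - w).  The t-derivative of sum_j f (p_j t) * kap_j is
   sum_j f' (p_j t) * (z_j - c), and t * (unity_root k - 1) times it is close to
   the telescoping sum of the f (p_(j+1) t) - f (p_j t), which vanishes. *)
Lemma circle_homotopy (e : R) : 0 < e -> \forall k \near \oo,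
  forall (w : C) (kap : nat -> C), normc (w - c) <= r ->
    (forall j, kap j * (circle_point c r k j - w) = circle_point c r k j - c) ->
  normc (\sum_(j < 2 ^ k.+1) f (circle_point c r k j) * kap j
         - f w * \sum_(j < 2 ^ k.+1) kap j) <= (2 ^ k.+1)%:R * (e * r).
Proof.
move=> e0; have [del del0 hdel] := disc_uniform_continuity f'C e0.
have dr0 : 0 < del / r by rewrite divr_gt0.
apply: filterS (unity_root_cvg dr0) => k hk w kap wr kapE.
set N := (2 ^ k.+1)%N; set om := unity_root k; set z := circle_point c r k.
have zr j : normc (z j - c) <= r by rewrite normc_circle_point // ltW.
have om1 : om - 1 != 0.
  rewrite subr_eq0; apply/eqP => om1.
  have := prim_order_dvd (unity_root_prim k) 1; rewrite -/om om1 expr1 eqxx dvdn1.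
  by rewrite expnS; case: (2 ^ k)%N (expn_gt0 2 k) => // -[].
have zS j : z j.+1 - z j = (z j - c) * (om - 1).
  by rewrite /z circle_pointB /circle_point exprSr -/om; ring.
have zN : z N = z 0.
  by rewrite /z /circle_point unity_root_exp expr0.
have omsum : \sum_(j < N) (z j - c) = 0.
  apply: (mulIf om1); rewrite mul0r mulr_suml.
  under eq_bigr => j _ do rewrite -zS.
  rewrite -(big_mkord xpredT (fun j => z j.+1 - z j)) telescope_sumr //.
  by rewrite zN subrr.
pose p (s : R) j := w + s%:C * (z j - w).
have pr s j : 0 <= s <= 1 -> normc (p s j - c) <= r by move=> s01; apply: convex_disc.
have bound s : 0 <= s <= 1 -> normc (\sum_(j < N) f' (p s j) * (z j - c)) <= N%:R * (e * r).
  move=> s01; have /andP[s0 s1] := s01.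
  (* The general argument ends by cancelling [s], which is impossible at [s = 0]; there all the
     [p s j] equal [w], and the [z j - c] sum to zero. *)
  case: (eqVneq s 0) => [->|sn0].
    have -> : \sum_(j < N) f' (p 0 j) * (z j - c) = 0.
      under eq_bigr => j _ do rewrite /p mul0r addr0.
      by rewrite -mulr_sumr omsum mulr0.
    by rewrite normc0 !mulr_ge0 // ltW.
  have sp : 0 < s by rewrite lt_def sn0.
  have pS j : p s j.+1 - p s j = s%:C * ((z j - c) * (om - 1)).
    by rewrite /p -zS; ring.
  have npS j : normc (p s j.+1 - p s j) <= s * (r * normc (om - 1)).
    rewrite pS !normcM normc_real // ler_wpM2l // ler_wpM2r ?normc_ge0 //.
  have npS' j : normc (p s j.+1 - p s j) < del.
    apply: le_lt_trans (npS j) _; move: hk; rewrite ltr_pdivlMr // mulrC -/om => hk.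
    apply: le_lt_trans hk; rewrite ler_piMl // mulr_ge0 ?normc_ge0 //; exact: ltW.
  have rem j : normc (f (p s j.+1) - f (p s j) - f' (p s j) * (p s j.+1 - p s j))
      <= e * (s * (r * normc (om - 1))).
    apply: le_trans (_ : _ <= e * normc (p s j.+1 - p s j)) _; last first.
      by rewrite ler_wpM2l // ltW.
    apply: segment_mean_value => t t01.
    have tr : normc (p s j + t%:C * (p s j.+1 - p s j) - c) <= r.
      by apply: convex_disc => //; exact: pr.
    split; first exact: fD.
    apply: hdel => //; first exact: pr.
    rewrite addrC addKr normcM normc_real; last by case/andP: t01.
    apply: le_lt_trans (npS' j); rewrite ler_piMl ?normc_ge0 //; by case/andP: t01.
  have : normc ((\sum_(j < N) f' (p s j) * (z j - c)) * (s%:C * (om - 1))) <=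
      N%:R * (e * (s * (r * normc (om - 1)))).
    have -> : (\sum_(j < N) f' (p s j) * (z j - c)) * (s%:C * (om - 1)) =
        - \sum_(j < N) (f (p s j.+1) - f (p s j) - f' (p s j) * (p s j.+1 - p s j)).
      rewrite sumrB -(big_mkord xpredT (fun j => f (p s j.+1) - f (p s j))).
      have pN : p s N = p s 0 by rewrite /p zN.
      rewrite telescope_sumr // pN subrr sub0r opprK mulr_suml.
      by apply: eq_bigr => j _; rewrite pS; ring.
    rewrite normcN; apply: le_trans (normc_sum _ _ _) _.
    apply: (@le_trans _ _ (\sum_(j < N) e * (s * (r * normc (om - 1))))).
      by apply: ler_sum => j _; exact: rem.
    by rewrite sumr_const card_ord mulr_natl.
  have q0 : 0 < s * normc (om - 1) by rewrite mulr_gt0 // normc_gt0.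
  rewrite normcM normcM normc_real // => h.
  rewrite -(ler_pM2r q0); apply: le_trans h _.
  by rewrite le_eqVlt; apply/orP; left; apply/eqP; ring.
pose F t := \sum_(j < N) f (w + t * (z j - w)) * kap j.
have -> : \sum_(j < N) f (z j) * kap j - f w * \sum_(j < N) kap j = F 1 - F 0.
  rewrite /F mulr_sumr; congr (_ - _); apply: eq_bigr => j _.
    by rewrite mul1r addrC subrK.
  by rewrite mul0r addr0.
apply: (@unit_segment_mean_value _ F
  (fun t => \sum_(j < N) f' (w + t * (z j - w)) * (z j - w) * kap j)).
  move=> s s01; apply: cderiv_sum => j; apply: cderivMr; apply: cderiv_affine.
  exact/fD/pr.
move=> s s01; apply: le_trans (bound s s01).
by under eq_bigr => j _ do rewrite -mulrA [_ * kap j]mulrC kapE.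
Qed.

(** The case [w = c], [kap = 1] of [circle_homotopy], divided by the number of nodes. *)
Lemma circle_mean_value : (fun k => circle_mean k c r f) @ \oo --> f c.
Proof.
apply/cvg_normcP => e e0; have er0 : 0 < e / r by rewrite divr_gt0.
apply: filterS (circle_homotopy er0) => k /(_ c (fun => 1)).
rewrite subrr normc0 => /(_ (ltW r_gt0) (fun j => mul1r _)).
rewrite mulfVK ?gt_eqF // sumr_const card_ord.
under eq_bigr => j _ do rewrite mulr1.
set S := bigop.body _ _ _; set N := (2 ^ k.+1)%N.
have N0 : (0 : R) < N%:R by rewrite ltr0n expn_gt0.
have NC0 : (N%:R : C) != 0 by rewrite pnatr_eq0 -lt0n expn_gt0.
rewrite -[S in normc (S - _)](mulVKf NC0) -/(circle_mean k c r f).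
rewrite [_ * N%:R]mulrC -mulrBr normcM normc_nat.
by rewrite ler_pM2l.
Qed.

End Disc.
End CauchyFormula.

Section CauchyKernelDerivative.
Variables (K : numFieldType) (f : K -> K) (c w z : K).
Hypotheses (zw : z - w != 0) (fz : derivable f z 1).

Definition cauchy_kernel_deriv (y : K) : K :=
  f y * ((y - w)^-1 - (y - c) * ((y - w)^-1 * (y - w)^-1)) + derive1 f y * ((y - c) * (y - w)^-1).

Let is_derive_sub_cst (a : K) : is_derive z 1 (fun y : K => y - a) 1.
Proof.
have -> : (fun y : K => y - a) = id - cst a by apply/funext.
by apply: is_derive_eq; rewrite subr0.
Qed.

Lemma is_derive_cauchy_kernel :
  is_derive z 1 (fun y => f y * ((y - c) * (y - w)^-1)) (cauchy_kernel_deriv z).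
Proof.
have dc := is_derive_sub_cst.
have df : is_derive z 1 f (derive1 f z) by rewrite derive1E; exact/derivableP.
have dw : is_derive z 1 (fun y : K => (y - w)^-1) (- (z - w) ^- 2).
  split; first by apply: derivableV.
  by rewrite deriveV // derive_val scaler1.
have h := is_deriveM df (is_deriveM (dc c) dw).
apply: (is_derive_eq h); rewrite /cauchy_kernel_deriv /GRing.scale /= expr2 invfM.
rewrite -[(_ * (fun y : K => _)) z]/((z - c) * (z - w)^-1); ring.
Qed.

Lemma continuous_cauchy_kernel_deriv :
  {for z, continuous (derive1 f)} -> {for z, continuous cauchy_kernel_deriv}.
Proof.
move=> f'c; have fc : {for z, continuous f}.
  by apply: differentiable_continuous; exact/derivable1_diffP.
have idc (a : K) : {for z, continuous (fun y : K => y - a)}.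
  apply: differentiable_continuous; apply/derivable1_diffP.
  by case: (is_derive_sub_cst a).
have ivc : {for z, continuous (fun y : K => (y - w)^-1)} by exact: (cvgV zw (idc w)).
exact: (cvgD (cvgM fc (cvgB ivc (cvgM (idc c) (cvgM ivc ivc)))) (cvgM f'c (cvgM (idc c) ivc))).
Qed.

End CauchyKernelDerivative.

Section CauchyKernel.
Variable R : realType.
Local Notation C := R[i].
Local Notation normc := (@ComplexField.Normc.normc R).

(** With [u = (w - c) / r], the kernel at the [j]-th node is [1 / (1 - u om^-j)]. Multiplied by
    [1 - u^N = 1 - (u om^-j)^N], it becomes a geometric sum in [i]; summing over [j] first leaves
    only [i = 0], by orthogonality of roots of unity. *)
Lemma circle_kernel_sum (c w : C) (r : R) (k : nat) : normc (w - c) < r ->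
  circle_mean k c r (fun z => (z - c) / (z - w)) =
  (1 - ((w - c) / r%:C) ^+ (2 ^ k.+1))^-1.
Proof.
move=> wr; set N := (2 ^ k.+1)%N; set om := unity_root R k; set u := (w - c) / r%:C.
have r0 : 0 < r by apply: le_lt_trans wr; exact: normc_ge0.
have rC0 : r%:C != 0 :> C by rewrite -normc_gt0 normc_real // ltW.
have om0 : om != 0 by rewrite -normc_gt0 normc_unity_root.
have zE j : circle_point c r k j - w = r%:C * om ^+ j * (1 - u * om ^- j).
  rewrite /circle_point /u -/om; field.
  by rewrite rC0 expf_neq0.
have zw j : circle_point c r k j - w != 0.
  rewrite -normc_gt0; apply: lt_le_trans (_ : 0 < r - normc (w - c)) _; first by rewrite subr_gt0.
  have := normcD (circle_point c r k j - w) (w - c).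
  rewrite subrKA (normc_circle_point _ _ _ (ltW r0)); lra.
have v1 j : 1 - u * om ^- j != 0 by have := zw j; rewrite zE mulf_eq0 negb_or => /andP[].
have kapE j : (circle_point c r k j - c) / (circle_point c r k j - w) = (1 - u * om ^- j)^-1.
  by rewrite zE circle_pointB -/om invfM mulrA mulfV ?mul1r // mulf_neq0 // expf_neq0.
have uN : normc (u ^+ N) < 1.
  rewrite normcX exprn_ilt1 ?normc_ge0 ?expn_eq0 //.
  by rewrite normcM normcV (normc_real (ltW r0)) ltr_pdivrMr // mul1r.
have uN1 : 1 - u ^+ N != 0.
  by rewrite subr_eq0; apply/eqP => E; move: uN; rewrite -E normc1 ltxx.
rewrite /circle_mean -/N; under eq_bigr => j _ do rewrite kapE.
have NC0 : (N%:R : C) != 0 by rewrite pnatr_eq0 -lt0n expn_gt0.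
have H : (1 - u ^+ N) * \sum_(j < N) (1 - u * om ^- j)^-1 = N%:R.
  rewrite mulr_sumr.
  have E (j : 'I_N) : (1 - u ^+ N) * (1 - u * om ^- j)^-1 = \sum_(i < N) u ^+ i * (om ^- i) ^+ j.
    have vN : (u * om ^- j) ^+ N = u ^+ N.
      by rewrite exprMn exprVn -exprM mulnC exprM unity_root_exp expr1n invr1 mulr1.
    rewrite -vN -[1 - (_ ^+ N)]opprB subrX1 -mulNr opprB mulrAC mulfV ?v1 // mul1r.
    by apply: eq_bigr => i _; rewrite exprMn !exprVn -!exprM mulnC.
  rewrite (eq_bigr _ (fun j _ => E j)) exchange_big /=.
  under eq_bigr => i _ do rewrite -mulr_sumr.
  have N_gt0 : (0 < N)%N by rewrite expn_gt0.
  rewrite (bigD1 (Ordinal N_gt0)) //= expr0 invr1 mul1r.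
  under eq_bigr => j _ do rewrite expr1n.
  rewrite sumr_const card_ord big1 ?addr0 // => i i0.
  have omi : om ^- i - 1 != 0.
    rewrite subr_eq0 -[1]invr1 (inj_eq invr_inj) -(prim_order_dvd (unity_root_prim R k)).
    apply/negP => /dvdn_leq h; suff : (N <= i)%N by rewrite leqNgt ltn_ord.
    by apply: h; rewrite lt0n; apply: contraNneq i0 => i0; apply/eqP/val_inj.
  suff -> : \sum_(j < N) (om ^- i) ^+ j = 0 by rewrite mulr0.
  apply: (mulfI omi); rewrite mulr0 -subrX1 exprVn -exprM mulnC exprM unity_root_exp.
  by rewrite expr1n invr1 subrr.
by rewrite -[X in _ * X](mulKf uN1) H mulrCA mulVf // mulr1.
Qed.

Lemma circle_kernel_cvg (c w : C) (r : R) : normc (w - c) < r ->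
  (fun k => circle_mean k c r (fun z => (z - c) / (z - w)) : R[i]^o) @ \oo --> (1 : R[i]^o).
Proof.
move=> wr.
have r0 : 0 < r by apply: le_lt_trans wr; exact: normc_ge0.
set u := (w - c) / r%:C.
have u1 : normc u < 1.
  by rewrite normcM normcV (normc_real (ltW r0)) ltr_pdivrMr // mul1r.
have -> : (fun k => circle_mean k c r (fun z => (z - c) / (z - w)) : R[i]^o) =
    (fun k => (1 - u ^+ (2 ^ k.+1))^-1 : R[i]^o).
  by apply/funext => k; rewrite circle_kernel_sum.
suff h : (fun k => (1 - u ^+ (2 ^ k.+1))^-1 : R[i]^o) @ \oo --> ((1 - 0)^-1 : R[i]^o).
  by rewrite subr0 invr1 in h.
apply: cvgV; first by rewrite subr0 oner_neq0.
apply: cvgB; first exact: cvg_cst.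
apply/cvg_normcP => e e0.
have h : (fun k => normc u ^+ k) @ \oo --> (0 : R).
  by apply: cvg_expr; rewrite ger0_norm // normc_ge0.
move/cvgrPdist_le/(_ _ e0): h; apply: filterS => k.
rewrite sub0r normrN ger0_norm ?exprn_ge0 ?normc_ge0 // => hk.
rewrite subr0 normcX; apply: le_trans hk.
apply: ler_wiXn2l; rewrite ?normc_ge0 //; first exact: ltW.
by apply: leq_trans (leqnSn _) _; exact/ltnW/ltn_expl.
Qed.

Variables (f : R[i]^o -> R[i]^o) (Omega : set R[i]^o).
Hypothesis fD : forall z, Omega z -> derivable f z 1.
Hypothesis f'C : forall z, Omega z -> {for z, continuous (derive1 f)}.
Variables (c w : C) (r : R).
Hypothesis r_gt0 : 0 < r.
Hypothesis disc : forall z, normc (z - c) <= r -> Omega z.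

(** [circle_homotopy] lets [f] be replaced by the constant [f w] in the mean, up to a vanishing
    error; what remains is the mean of the kernel, which tends to 1. *)
Lemma circle_cauchy_inside : normc (w - c) < r ->
  (fun k => circle_mean k c r (fun z => f z * ((z - c) / (z - w))) : R[i]^o) @ \oo --> f w.
Proof.
move=> wr.
have fD' z : normc (z - c) <= r -> cderiv f z (derive1 f z).
  by move=> /disc /fD h; apply/cderivP; rewrite derive1E; exact/derivableP.
have f'C' z : normc (z - c) <= r -> {for z, continuous (derive1 f)} by move=> /disc /f'C.
have := circle_kernel_cvg wr => hk.
have hk' : (fun k => f w * circle_mean k c r (fun z => (z - c) / (z - w)) : R[i]^o) @ \oo -->
    (f w * 1 : R[i]^o) by exact: cvg_normcMl.
rewrite mulr1 in hk'.
apply/cvg_normcP => e e0; have e20 : 0 < e / 2 by rewrite divr_gt0.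
have er0 : 0 < e / 2 / r by rewrite divr_gt0.
move/cvg_normcP/(_ _ e20): hk' => hk'.
apply: filterS2 hk' (circle_homotopy r_gt0 fD' f'C' er0) => k hk1.
move=> /(_ w (fun j => (circle_point c r k j - c) / (circle_point c r k j - w)) (ltW wr)).
have zw j : circle_point c r k j - w != 0.
  rewrite -normc_gt0; apply: lt_le_trans (_ : 0 < r - normc (w - c)) _; first by rewrite subr_gt0.
  have := normcD (circle_point c r k j - w) (w - c).
  rewrite subrKA (normc_circle_point _ _ _ (ltW r_gt0)); lra.
move=> /(_ (fun j => divfK (zw j) _)) h.
have NC0 : (0 : R) < (2 ^ k.+1)%:R by rewrite ltr0n expn_gt0.
have h2 : normc (circle_mean k c r (fun z => f z * ((z - c) / (z - w)))
   - f w * circle_mean k c r (fun z => (z - c) / (z - w))) <= e / 2.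
  rewrite /circle_mean mulrCA -mulrBr normcM normcV normc_nat.
  by rewrite ler_pdivrMl //; move: h; rewrite divfK ?gt_eqF.
apply: le_trans (normc_triangle (f w * circle_mean k c r (fun z => (z - c) / (z - w))) _ _) _.
by rewrite [e]splitr lerD.
Qed.

(** The pole [w] is off the closed disc, so [f] times the kernel is itself C^1 there: its means tend
    to its value at [c], which is 0 because of the factor [z - c]. *)
Lemma circle_cauchy_outside : r < normc (w - c) ->
  (fun k => circle_mean k c r (fun z => f z * ((z - c) / (z - w))) : R[i]^o) @ \oo --> (0 : R[i]^o).
Proof.
move=> wr.
pose g : R[i]^o -> R[i]^o := fun z => f z * ((z - c) / (z - w)).
have gc : g c = 0 by rewrite /g subrr mul0r mulr0.
rewrite -gc.
have zw z : normc (z - c) <= r -> z - w != 0 :> C.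
  move=> zr; rewrite subr_eq0; apply/eqP => E; move: zr; rewrite E; lra.
have gD z : normc (z - c) <= r -> cderiv g z (cauchy_kernel_deriv f c w z).
  move=> zr; apply/cderivP.
  exact: (@is_derive_cauchy_kernel R[i] f c w z (zw z zr) (fD (disc zr))).
apply: (circle_mean_value r_gt0 gD) => z zr.
exact: (@continuous_cauchy_kernel_deriv R[i] f c w z (zw z zr) (fD (disc zr)) (f'C (disc zr))).
Qed.


End CauchyKernel.

(** * One family of nodes for several centers *)

Section Quadrature.
Variable R : realType.
Local Notation C := R[i].
Local Notation normc := (@ComplexField.Normc.normc R).

Lemma uniform_radius (T : eqType) (s : seq T) (P : T -> R -> Prop) :
  (forall c rho rho', P c rho -> 0 < rho' <= rho -> P c rho') ->
  (forall c, c \in s -> exists2 rho, 0 < rho & P c rho) ->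
  exists2 rho, 0 < rho & forall c, c \in s -> P c rho.
Proof.
move=> Pdown; elim: s => [|c s IH] h; first by exists 1.
have [|r1 r10 h1] := IH; first by move=> x xs; apply: h; rewrite inE xs orbT.
have [r2 r20 h2] := h c (mem_head _ _).
exists (Num.min r1 r2); first by rewrite lt_min r10.
move=> x; rewrite inE => /predU1P[->|/h1 hx].
  by apply: Pdown h2 _; rewrite lt_min r10 r20 ge_min lexx orbT.
by apply: Pdown hx _; rewrite lt_min r10 r20 ge_min lexx.
Qed.

(** Walk from [c] to [z] along a radius in steps of length at most [del / 2]: by uniform continuity
    [g] changes by at most 1 at each step. *)
Lemma disc_bounded (g : R[i]^o -> R[i]^o) (c : C) (r : R) : 0 <= r ->
  (forall z, normc (z - c) <= r -> {for z, continuous g}) ->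
  exists2 M : R, 0 <= M & forall z, normc (z - c) <= r -> normc (g z) <= M.
Proof.
move=> r0 gc; have [del del0 h] := disc_uniform_continuity gc (@ltr01 R).
have key n z : normc (z - c) <= r -> normc (z - c) <= n%:R * (del / 2) ->
    normc (g z - g c) <= n%:R.
  elim: n z => [|n IH] z zr; rewrite ?mul0r => zn.
    case: (eqVneq z c) => [->|zc]; first by rewrite subrr normc0.
    by move: zn; rewrite leNgt normc_gt0 subr_eq0 zc.
  have n1 : 0 < n.+1%:R :> R by rewrite ltr0n.
  pose t : R := n%:R / n.+1%:R.
  have t01 : 0 <= t <= 1.
    by rewrite divr_ge0 ?ler0n //= ler_pdivrMr // mul1r ler_nat.
  have zE : c + t%:C * (z - c) - c = t%:C * (z - c) by rewrite addrC addKr.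
  have tn : normc (t%:C * (z - c)) = t * normc (z - c).
    by rewrite normcM normc_real //; case/andP: t01.
  have nE : n%:R = t * n.+1%:R by rewrite divfK ?gt_eqF.
  have z'r : normc (c + t%:C * (z - c) - c) <= r.
    rewrite zE tn; apply: le_trans zr; rewrite ler_piMl ?normc_ge0 //; by case/andP: t01.
  have h1 : normc (g (c + t%:C * (z - c)) - g c) <= n%:R.
    apply: IH => //; rewrite zE tn nE -mulrA ler_wpM2l //; by case/andP: t01.
  have h2 : normc (g z - g (c + t%:C * (z - c))) <= 1.
    apply: h => //.
    have -> : z - (c + t%:C * (z - c)) = (1 - t)%:C * (z - c).
      by rewrite rmorphB rmorph1 /=; ring.
    rewrite normcM normc_real; last by rewrite subr_ge0; case/andP: t01.
    have t1 : (1 - t) * n.+1%:R = 1 by rewrite mulrBl -nE mul1r -natr1 addrC addKr.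
    have /andP[_ t1'] := t01.
    have t1'' : 0 <= 1 - t by rewrite subr_ge0.
    have := ler_wpM2l t1'' zn; rewrite [_ * (n.+1%:R * _)]mulrA t1 mul1r => h2.
    by apply: le_lt_trans h2 _; rewrite ltr_pdivrMr // ltr_pMr // ltr1n.
  by apply: le_trans (normc_triangle (g (c + t%:C * (z - c))) _ _) _; rewrite -natr1 addrC lerD.
pose n := (Num.trunc (r / (del / 2))).+1.
exists (normc (g c) + n%:R) => [|z zr]; first by rewrite addr_ge0 ?normc_ge0.
rewrite -[g z](subrK (g c)); apply: le_trans (normcD _ _) _; rewrite addrC lerD //.
apply: key => //; apply: le_trans zr _.
by rewrite -ler_pdivrMr ?divr_gt0 // ltW // truncnS_gt.
Qed.


Variables (f : R[i]^o -> R[i]^o) (Omega : set R[i]^o).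
Hypothesis Oopen : open Omega.
Hypothesis fD : forall z, Omega z -> derivable f z 1.
Hypothesis f'C : forall z, Omega z -> {for z, continuous (derive1 f)}.

(* A node is a pair (weight, point). *)
Definition cauchy_nodes (cs : seq C) (r : R) (k : nat) : seq (C * C) :=
  [seq ((2 ^ k.+1)%:R^-1 * (f (circle_point c r k j) * (circle_point c r k j - c)),
        circle_point c r k j) | c <- cs, j <- iota 0 (2 ^ k.+1)].

Lemma cauchy_nodes_sum cs r k (V : lmodType C) (g : C -> V) :
  \sum_(p <- cauchy_nodes cs r k) p.1 *: g p.2 =
  \sum_(c <- cs) (2 ^ k.+1)%:R^-1 *: \sum_(j < 2 ^ k.+1)
    (f (circle_point c r k j) * (circle_point c r k j - c)) *: g (circle_point c r k j).
Proof.
rewrite big_allpairs_dep /=; apply: eq_bigr => c _; rewrite scaler_sumr.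
rewrite -[X in iota _ X]subn0 big_mkord; apply: eq_bigr => j _.
by rewrite scalerA.
Qed.

(** A discrete stand-in for the Cauchy integral along circles around all of [cs]. The later
    estimates use only these fields, not the shape of the nodes. *)
Record quadrature (cs : seq C) (r : R) (nodes : nat -> seq (C * C)) (W : R) : Prop :=
  Quadrature {
    quad_radius : 0 < r;
    quad_dist : forall k p c, p \in nodes k -> c \in cs -> r <= normc (p.2 - c);
    quad_weight : forall k, \sum_(p <- nodes k) normc p.1 <= W;
    quad_cvg : forall w c, c \in cs -> normc (w - c) < r ->
      (fun k => \sum_(p <- nodes k) p.1 * (p.2 - w)^-1 : R[i]^o) @ \oo --> f w }.

(** The radius keeps the discs inside [Omega] and distinct centers [2 r] apart. A point within [r]
    of one center is then outside every other disc, so its own circle contributes [f w] and the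
    others 0. *)
Lemma quadrature_exists (cs : seq C) : (forall c, c \in cs -> Omega c) ->
  exists r nodes W, quadrature cs r nodes W.
Proof.
move=> csO.
have [r r0 hr] : exists2 r, 0 < r & forall c, c \in cs ->
    (forall z, normc (z - c) <= r -> Omega z) /\
    (forall c', c' \in cs -> c' != c -> r + r <= normc (c' - c)).
  apply: uniform_radius => [c rho rho' [h1 h2] /andP[rho'0 rr]|c ccs].
    split=> [z zr|c' c's c'c]; first by apply: h1; apply: le_trans rr.
    by apply: le_trans (h2 _ c's c'c); rewrite lerD.
  have /nbhs_normc[d1 d10 hd1] : \forall y \near (c : R[i]^o), Omega y.
    exact: open_nbhs_nbhs (conj Oopen (csO c ccs)).
  have [d2 d20 hd2] : exists2 rho, 0 < rho & forall c', c' \in cs ->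
      c' != c -> rho + rho <= normc (c' - c).
    apply: uniform_radius => [c' rho rho' h /andP[_ rr] /h|c' _].
      by apply: le_trans; rewrite lerD.
    case: (eqVneq c' c) => [->|c'c]; first by exists 1.
    exists (normc (c' - c) / 2) => [|_]; last by rewrite -splitr.
    by rewrite divr_gt0 // normc_gt0 subr_eq0.
  exists (Num.min (d1 / 2) d2); first by rewrite lt_min d20 divr_gt0.
  split=> [z|c' c's c'c].
    rewrite le_min => /andP[zd _]; apply: hd1; lra.
  apply: le_trans (hd2 c' c's c'c).
  by rewrite lerD // ge_min lexx orbT.
have fC z : Omega z -> {for z, continuous f}.
  by move=> Oz; apply: differentiable_continuous; apply/derivable1_diffP; exact: fD.
have [M M0 hM] : exists2 M, 0 <= M & forall c, c \in cs ->
    forall z, normc (z - c) <= r -> normc (f z) <= M.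
  have : forall c, c \in cs -> exists2 M, 0 <= M & forall z, normc (z - c) <= r -> normc (f z) <= M.
    move=> c /hr[h1 _]; apply: disc_bounded; first exact: ltW.
    by move=> z /h1/fC.
  elim: (cs) => [|c s IH] h; first by exists 0.
  have [|M1 M10 h1] := IH; first by move=> x xs; apply: h; rewrite inE xs orbT.
  have [M2 M20 h2] := h c (mem_head _ _).
  exists (Num.max M1 M2); first by rewrite le_max M10.
  move=> x; rewrite inE => /predU1P[->|/h1 hx] z zr.
    by rewrite le_max h2 ?orbT.
  by rewrite le_max hx.
(* An eigenvalue shared by several Jordan blocks must be circled once only, hence [undup]. Each of
   the [N] weights of a circle has modulus at most [M r / N], which gives the total. *)
exists r, (cauchy_nodes (undup cs) r), (\sum_(c <- undup cs) M * r); split=> //.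
- move=> k p c /allpairsPdep[c' [j [c's _ ->]]] ccs /=.
  rewrite mem_undup in c's.
  case: (eqVneq c' c) => [->|c'c]; first by rewrite normc_circle_point // ltW.
  have [_ /(_ c' c's c'c)] := hr c ccs.
  have := normc_triangle (circle_point c' r k j) c' c.
  rewrite [X in _ <= X + _]normc_distC (normc_circle_point _ _ _ (ltW r0)); lra.
- move=> k; rewrite /cauchy_nodes big_allpairs_dep /= big_seq [X in _ <= X]big_seq.
  apply: ler_sum => c; rewrite mem_undup => ccs.
  rewrite -[X in iota _ X]subn0 big_mkord.
  have N0 : (0 : R) < (2 ^ k.+1)%:R by rewrite ltr0n expn_gt0.
  apply: (@le_trans _ _ (\sum_(j < 2 ^ k.+1) (2 ^ k.+1)%:R^-1 * (M * r))).
    apply: ler_sum => j _; rewrite !normcM normcV normc_nat.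
    rewrite (normc_circle_point _ _ _ (ltW r0)).
    apply: ler_wpM2l; first by rewrite invr_ge0 ltW.
    apply: ler_wpM2r; first exact: ltW.
    by apply: (hM c) => //; rewrite (normc_circle_point _ _ _ (ltW r0)).
  by rewrite sumr_const card_ord -mulrnAl -mulr_natr mulVf ?gt_eqF // mul1r.
move=> w c ccs wc.
have -> : (fun k => \sum_(p <- cauchy_nodes (undup cs) r k) p.1 * (p.2 - w)^-1 : R[i]^o) =
   (fun k => \sum_(c' <- undup cs)
     circle_mean k c' r (fun z => f z * ((z - c') / (z - w))) : R[i]^o).
  apply/funext => k; rewrite (@cauchy_nodes_sum _ _ _ R[i]^o (fun z => (z - w)^-1)).
  apply: eq_bigr => c' _; rewrite /circle_mean; congr (_ * _); apply: eq_bigr => j _.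
  by rewrite mulrA.
have -> : f w = \sum_(c' <- undup cs) if c' == c then f w else 0.
  rewrite (bigD1_seq c) ?mem_undup ?undup_uniq //= eqxx big1 ?addr0 // => c' /negPf -> //.
(* Membership is put inside the summand because [cvg_normc_sum] asks for convergence at every index,
   listed or not. *)
have big_seq_if (F : C -> C) : \sum_(c' <- undup cs) F c' =
    \sum_(c' <- undup cs) (if c' \in cs then F c' else 0).
  by apply: eq_big_seq => c'; rewrite mem_undup => ->.
rewrite big_seq_if; under eq_fun do rewrite big_seq_if.
apply: cvg_normc_sum => c'; case: ifP => c's; last exact: cvg_cst.
have [disc sep] := hr c' c's; case: eqVneq => [->|c'c].
  exact: (circle_cauchy_inside fD f'C r0 (hr c ccs).1).
apply: (circle_cauchy_outside fD f'C r0 disc).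
have := sep c ccs; rewrite eq_sym => /(_ c'c); have := normc_triangle w c c'.
rewrite [X in _ <= X + _]normc_distC; lra.
Qed.


End Quadrature.

(** * Cauchy's formula for the derivatives *)

Section QuadratureDerivatives.
Variable R : realType.
Local Notation C := R[i].
Local Notation normc := (@ComplexField.Normc.normc R).

(** Meant for [a = (z - w - h)^-1] and [b = (z - w)^-1], for which [a - b = h a b]: it is the Taylor
    expansion of [(z - w)^-m] in [w], with [K] depending only on [M] and [m], hence the same for all
    nodes. In the induction, using [a - b = h a b] repeatedly brings out [h^2]. *)
Lemma inv_pow_taylor (M : R) (m : nat) : 0 <= M -> exists2 K : R, 0 <= K &
  forall a b h : C, normc a <= M -> normc b <= M -> a - b = h * a * b ->
    normc (a ^+ m - b ^+ m - m%:R * h * b ^+ m.+1) <= K * normc h ^+ 2.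
Proof.
move=> M0; elim: m => [|m [K K0 IH]].
  exists 0 => // a b h _ _ _; rewrite !expr0 subrr mul0r mul0r subr0 normc0.
  by rewrite mul0r.
exists (M * K + m.+1%:R * M ^+ m.+3) => [|a b h aM bM ab].
  by apply: addr_ge0; apply: mulr_ge0 => //; exact: exprn_ge0.
have -> : a ^+ m.+1 - b ^+ m.+1 - m.+1%:R * h * b ^+ m.+2 =
    a * (a ^+ m - b ^+ m - m%:R * h * b ^+ m.+1) + m.+1%:R * h ^+ 2 * a * b ^+ m.+2.
  have -> : a ^+ m.+1 - b ^+ m.+1 - m.+1%:R * h * b ^+ m.+2 =
      a * (a ^+ m - b ^+ m - m%:R * h * b ^+ m.+1) + (a - b) * b ^+ m
      + m%:R * h * b ^+ m.+1 * (a - b) - h * b ^+ m.+2.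
    by rewrite -natr1 !exprS; ring.
  rewrite ab -natr1 !exprS.
  have -> : h * a * b * b ^+ m = h * (a - b) * (b * b ^+ m) + h * (b * (b * b ^+ m)) by ring.
  by rewrite ab; ring.
apply: le_trans (normcD _ _) _; rewrite mulrDl lerD //.
  by rewrite normcM -(mulrA M); apply: ler_pM; rewrite ?normc_ge0 //; exact: IH.
rewrite 3!normcM !normcX normc_nat.
have -> : m.+1%:R * M ^+ m.+3 * normc h ^+ 2 = m.+1%:R * normc h ^+ 2 * M * M ^+ m.+2.
  by rewrite [M ^+ m.+3]exprS; ring.
have h0 := normc_ge0 h; have a0 := normc_ge0 a; have b0 := normc_ge0 b.
have m0 : 0 <= m.+1%:R :> R := ler0n _ _.
have h20 : 0 <= normc h ^+ 2 := exprn_ge0 _ h0.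
apply: ler_pM; first by rewrite !mulr_ge0.
- exact: exprn_ge0.
- by apply: ler_wpM2l aM; rewrite mulr_ge0.
by apply: lerXn2r; rewrite ?nnegrE.
Qed.

Variables (f : R[i]^o -> R[i]^o) (cs : seq C) (r : R).
Variables (nodes : nat -> seq (C * C)) (W : R).
Hypothesis quad : quadrature f cs r nodes W.

Definition near_centers (w : C) := exists2 c, c \in cs & normc (w - c) < r.

Lemma near_centers_dist w : near_centers w -> exists2 del : R, 0 < del &
  (forall w', normc (w' - w) < del -> near_centers w') /\
  (forall k p, p \in nodes k -> del <= normc (p.2 - w)).
Proof.
move=> [c ccs wc]; exists (r - normc (w - c)); first by rewrite subr_gt0.
split=> [w' w'w|k p pk].
  exists c => //; apply: le_lt_trans (normc_triangle w _ _) _; lra.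
have := quad_dist quad pk ccs; have := normc_triangle w p.2 c; lra.
Qed.

Lemma quad_bound (k : nat) (g : C -> C) (B : R) :
  0 <= B -> (forall p, p \in nodes k -> normc (g p.2) <= B) ->
  normc (\sum_(p <- nodes k) p.1 * g p.2) <= W * B.
Proof.
move=> B0 gB; apply: le_trans (normc_sum _ _ _) _.
apply: le_trans (_ : (\sum_(p <- nodes k) normc p.1) * B <= _); last first.
  by rewrite ler_wpM2r // (quad_weight quad).
rewrite mulr_suml big_seq [X in _ <= X]big_seq; apply: ler_sum => p pk.
by rewrite normcM ler_wpM2l ?normc_ge0 // gB.
Qed.

(** For [m >= 1], the approximation of the Cauchy integral for the derivative of order [m - 1]
    divided by [(m - 1)!]. *)
Definition quad_sum (m k : nat) (w : C) : C := \sum_(p <- nodes k) p.1 * (p.2 - w) ^- m.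

Lemma quad_sum_taylor (m : nat) (w : C) : near_centers w ->
  exists2 del : R, 0 < del & exists2 K : R, 0 <= K &
    forall k h, normc h < del -> near_centers (w + h) /\
      normc (quad_sum m k (w + h) - quad_sum m k w - m%:R * h * quad_sum m.+1 k w)
        <= K * normc h ^+ 2.
Proof.
move=> /near_centers_dist[del del0 [hU hdel]].
have M0 : 0 <= 2 / del by rewrite divr_ge0 // ltW.
have [K K0 hK] := inv_pow_taylor m M0.
have d20 : 0 < del / 2 by rewrite divr_gt0.
have W0 : 0 <= W.
  by apply: le_trans (quad_weight quad 0); apply: sumr_ge0 => p _; exact: normc_ge0.
exists (del / 2) => //; exists (W * K); first by rewrite mulr_ge0.
move=> k h hh; split.
  by apply: hU; rewrite addrC addKr; lra.
pose g z := (z - (w + h))^-1 ^+ m - (z - w)^-1 ^+ m - m%:R * h * (z - w)^-1 ^+ m.+1.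
have -> : quad_sum m k (w + h) - quad_sum m k w - m%:R * h * quad_sum m.+1 k w =
    \sum_(p <- nodes k) p.1 * g p.2.
  rewrite /quad_sum mulr_sumr -!sumrB; apply: eq_bigr => p _.
  by rewrite /g -!exprVn; ring.
rewrite -mulrA; apply: (@quad_bound k g) => [|p pk].
  by rewrite mulr_ge0 // exprn_ge0 // normc_ge0.
have d1 := hdel k p pk.
have d2 : del / 2 <= normc (p.2 - (w + h)).
  have := normc_triangle (w + h) p.2 w.
  rewrite [w + h - w](addrC) addKr; lra.
have inv_le x : del / 2 <= normc x -> normc x^-1 <= 2 / del.
  by move=> hx; rewrite normcV -[2 / del]invrK invf_div lef_pV2 // posrE // (lt_le_trans d20).
have i1 : normc (p.2 - (w + h))^-1 <= 2 / del by apply: inv_le; lra.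
have i2 : normc (p.2 - w)^-1 <= 2 / del by apply: inv_le; lra.
apply: hK => //.
have z1 : p.2 - (w + h) != 0 by rewrite -normc_gt0; lra.
have z2 : p.2 - w != 0 by rewrite -normc_gt0; lra.
by field; rewrite z1 z2.
Qed.

(** By [quad_sum_taylor], [quad_sum m.+1 k w] is close, uniformly in [k], to a difference quotient
    of [quad_sum m k], which converges to that of [g]; so it is Cauchy in [k]. Letting [k] grow in
    the Taylor estimate then gives the derivative of [g]. *)
Lemma quad_derivative (m : nat) (g : C -> C) : (0 < m)%N ->
  (forall w, near_centers w -> (fun k => quad_sum m k w : R[i]^o) @ \oo --> (g w : R[i]^o)) ->
  forall w, near_centers w -> exists2 D : C,
    (fun k => quad_sum m.+1 k w : R[i]^o) @ \oo --> (D : R[i]^o) & cderiv g w (m%:R * D).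
Proof.
move=> m0 gl w wU; have [del del0 [K K0 hT]] := quad_sum_taylor m wU.
have m0R : 0 < m%:R :> R by rewrite ltr0n.
have mC : m%:R != 0 :> C by rewrite pnatr_eq0 -lt0n.
have [D hD] : exists D : C, (fun k => quad_sum m.+1 k w) @ \oo --> (D : R[i]^o).
  apply: cauchy_complex => e e0.
  (* [h] stays within the range of the Taylor estimate, and its error [K h^2] is at most half of
     [e m h]; the two errors [eta] below make up the other half. *)
  pose h : R := Num.min (del / 2) (e / (2 * (K + 1))).
  have K1 : 0 < 2 * (K + 1) by rewrite mulr_gt0 // ltr_wpDl.
  have h0 : 0 < h by rewrite lt_min !divr_gt0.
  have hdel : normc h%:C < del.
    rewrite normc_real ?ltW // gt_min; apply/orP; left.
    by rewrite ltr_pdivrMr // ltr_pMr // ltr1n.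
  have hK : K * h <= e / 2.
    apply: le_trans (_ : (K + 1) * h <= _); first by rewrite ler_wpM2r ?lerDl // ltW.
    rewrite -ler_pdivlMl ?ltr_wpDl // ge_min; apply/orP; right.
    by rewrite invfM mulrA (mulrC (K + 1)^-1) lexx.
  have hC0 : h%:C != 0 :> C by rewrite -normc_gt0 normc_real // ltW.
  have [whU _] := hT 0 _ hdel.
  exists ((g (w + h%:C) - g w) / (m%:R * h%:C)).
  pose eta := e * (m%:R * h) / 4.
  have eta0 : 0 < eta by rewrite divr_gt0 // !mulr_gt0.
  move/cvg_normcP/(_ _ eta0): (gl _ wU) => h1.
  move/cvg_normcP/(_ _ eta0): (gl _ whU) => h2.
  apply: filterS2 h1 h2 => k h1 h2.
  have [_ h3] := hT k _ hdel; rewrite normc_real ?(ltW h0) // in h3.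
  have mh0 : 0 < m%:R * h by rewrite mulr_gt0.
  rewrite -(ler_pM2l mh0) -[X in X * normc _ <= _](normc_real (ltW mh0)).
  rewrite -normcM rmorphM /= rmorph_nat.
  rewrite mulrBr [X in _ - X]mulrCA mulfV ?mulf_neq0 // mulr1.
  have -> : m%:R * h%:C * quad_sum m.+1 k w - (g (w + h%:C) - g w) =
     (quad_sum m k (w + h%:C) - g (w + h%:C)) - (quad_sum m k w - g w)
     - (quad_sum m k (w + h%:C) - quad_sum m k w - m%:R * h%:C * quad_sum m.+1 k w) by ring.
  apply: le_trans (normcB _ _) _.
  have h4 := normcB (quad_sum m k (w + h%:C) - g (w + h%:C)) (quad_sum m k w - g w).
  have h5 : K * h ^+ 2 <= e / 2 * (m%:R * h).
    rewrite expr2 mulrA; apply: ler_pM => //; rewrite ?mulr_ge0 ?(ltW h0) //.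
    by rewrite ler_peMl ?(ltW h0) // ler1n.
  rewrite /eta in h1 h2; lra.
exists D => //.
have est h : normc h < del -> normc (g (w + h) - g w - m%:R * D * h) <= K * normc h ^+ 2.
  move=> hh; have [whU _] := hT 0 _ hh.
  have lim : (fun k =>
      quad_sum m k (w + h) + (- quad_sum m k w) + (- (m%:R * h * quad_sum m.+1 k w)) : R[i]^o)
      @ \oo --> (g (w + h) + (- g w) + (- (m%:R * h * D)) : R[i]^o).
    have hD' : (fun k => m%:R * h * quad_sum m.+1 k w : R[i]^o) @ \oo --> (m%:R * h * D : R[i]^o).
      exact: cvg_normcMl.
    by apply: cvgD; [apply: cvgD; [exact: gl|apply: cvgN; exact: gl]|exact: cvgN].
  rewrite mulrAC; apply: cvg_normc_le lim _; apply: nearW => k.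
  by have [] := hT k _ hh.
move=> e e0; exists (Num.min del (e / (K + 1))).
  by rewrite lt_min del0 divr_gt0 // ltr_wpDl.
move=> h; rewrite lt_min => /andP[hd]; rewrite ltr_pdivlMr ?ltr_wpDl // => hK.
apply: le_trans (est h hd) _; rewrite expr2 mulrA ler_wpM2r ?normc_ge0 //.
have := normc_ge0 h; lra.
Qed.

(** Induction on [l], starting from [quad_cvg]: each step differentiates the limit just identified,
    so all the derivatives are obtained from a C^1 assumption. *)
Lemma quad_derive1n (l : nat) (w : C) : near_centers w ->
  (fun k => quad_sum l.+1 k w : R[i]^o) @ \oo --> (derive1n l f w / l`!%:R : R[i]^o).
Proof.
elim: l w => [|l IH] w wU.
  rewrite fact0 divr1; have [c ccs wc] := wU.
  have := quad_cvg quad ccs wc; rewrite /quad_sum.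
  by under [in X in _ -> X]eq_fun do under eq_bigr do rewrite expr1.
have [D hD gD] := quad_derivative (ltn0Sn l) IH wU.
have f0 n : n`!%:R != 0 :> C by rewrite pnatr_eq0 -lt0n fact_gt0.
have -> : derive1n l.+1 f w = l`!%:R * (l.+1%:R * D).
  apply: cderiv_derive1; have := cderivMr (l`!%:R) gD.
  rewrite mulrC; congr cderiv; apply/funext => y; by rewrite divfK.
have -> : l`!%:R * (l.+1%:R * D) / l.+1`!%:R = D.
  by rewrite mulrCA mulrA -natrM -factS mulrAC mulfV // mul1r.
exact: hD.
Qed.

End QuadratureDerivatives.

(** * Matrix functions as limits of resolvent sums *)

Section MatrixNorm.
Variable R : realType.
Local Notation C := R[i].
Local Notation normc := (@ComplexField.Normc.normc R).

(** The entrywise sum is submultiplicative, also for rectangular matrices, with no constant. *)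
Definition mnorm m n (A : 'M[C]_(m, n)) : R := \sum_a \sum_b normc (A a b).

Lemma mnorm_ge0 m n (A : 'M[C]_(m, n)) : 0 <= mnorm A.
Proof. by apply: sumr_ge0 => a _; apply: sumr_ge0 => b _; exact: normc_ge0. Qed.

Lemma mnorm_entry m n (A : 'M[C]_(m, n)) a b : normc (A a b) <= mnorm A.
Proof.
rewrite /mnorm (bigD1 a) //= (bigD1 b) //= -addrA lerDl addr_ge0 ?sumr_ge0 // => *.
  exact: normc_ge0.
by apply: sumr_ge0 => *; exact: normc_ge0.
Qed.

Lemma mnorm_eq0 m n (A : 'M[C]_(m, n)) : mnorm A <= 0 -> A = 0.
Proof.
move=> A0; apply/matrixP => a b; rewrite mxE; apply/eqP.
have := le_trans (mnorm_entry A a b) A0.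
by rewrite leNgt normc_gt0 negbK.
Qed.

Lemma mnorm0 m n : mnorm (0 : 'M[C]_(m, n)) = 0.
Proof. by rewrite /mnorm big1 // => a _; rewrite big1 // => b _; rewrite mxE normc0. Qed.

Lemma mnormD m n (A B : 'M[C]_(m, n)) : mnorm (A + B) <= mnorm A + mnorm B.
Proof.
rewrite /mnorm -big_split; apply: ler_sum => a _; rewrite -big_split; apply: ler_sum => b _.
by rewrite mxE normcD.
Qed.

Lemma mnormM m n p (A : 'M[C]_(m, n)) (B : 'M[C]_(n, p)) : mnorm (A *m B) <= mnorm A * mnorm B.
Proof.
rewrite /mnorm mulr_suml; apply: ler_sum => a _.
apply: (@le_trans _ _ (\sum_b \sum_j normc (A a j) * normc (B j b))).
  apply: ler_sum => b _; rewrite mxE; apply: le_trans (normc_sum _ _ _) _.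
  by apply: ler_sum => j _; rewrite normcM.
rewrite exchange_big mulr_suml; apply: ler_sum => j _.
rewrite -mulr_sumr ler_wpM2l ?normc_ge0 //.
rewrite [X in _ <= X](bigD1 j) //= lerDl; apply: sumr_ge0 => i _.
by apply: sumr_ge0 => *; exact: normc_ge0.
Qed.

Lemma mnorm_sum (I : Type) (s : seq I) m n (F : I -> 'M[C]_(m, n)) :
  mnorm (\sum_(i <- s) F i) <= \sum_(i <- s) mnorm (F i).
Proof.
elim/big_rec2: _ => [|i x y _ h]; first by rewrite mnorm0.
by rewrite (le_trans (mnormD _ _)) // lerD2l.
Qed.

Definition mcvg m n (X : nat -> 'M[C]_(m, n)) (L : 'M[C]_(m, n)) : Prop :=
  forall a b, (fun k => X k a b : R[i]^o) @ \oo --> (L a b : R[i]^o).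

Lemma mcvg_unique m n (X : nat -> 'M[C]_(m, n)) L1 L2 : mcvg X L1 -> mcvg X L2 -> L1 = L2.
Proof. by move=> h1 h2; apply/matrixP => a b; apply: cvg_normc_unique (h1 a b) (h2 a b). Qed.

Lemma mcvg_sum (I : Type) (s : seq I) m n (X : I -> nat -> 'M[C]_(m, n)) L :
  (forall i, mcvg (X i) (L i)) -> mcvg (fun k => \sum_(i <- s) X i k) (\sum_(i <- s) L i).
Proof.
move=> h a b; rewrite summxE; under eq_fun do rewrite summxE.
by apply: cvg_normc_sum => i; exact: h.
Qed.

Lemma mcvg_mul m n p q (A : 'M[C]_(m, n)) (B : 'M[C]_(p, q)) X L :
  mcvg X L -> mcvg (fun k => A *m X k *m B) (A *m L *m B).
Proof.
move=> h a b; rewrite !mxE; under eq_fun do rewrite !mxE.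
apply: cvg_normc_sum => c.
under eq_fun do rewrite mulrC; rewrite mulrC; apply: cvg_normcMl.
rewrite mxE; under eq_fun do rewrite mxE.
by apply: cvg_normc_sum => d; apply: cvg_normcMl; exact: h.
Qed.

End MatrixNorm.

(** * Resolvents: identities and bounds *)

Section Resolvent.
Variable R : realType.
Local Notation C := R[i].
Local Notation normc := (@ComplexField.Normc.normc R).

Definition resolvent n (A : 'M[C]_n) (z : C) : 'M[C]_n := invmx (z%:M - A).

Lemma invmx_uniq n (A B : 'M[C]_n) : A *m B = 1%:M -> A \in unitmx /\ invmx A = B.
Proof.
move=> AB; have [Au _] := mulmx1_unit AB; split=> //.
by rewrite -[LHS]mulmx1 -AB mulKmx.
Qed.

Lemma unitmx_eigenvalue n (A : 'M[C]_n) z : (z%:M - A \in unitmx) = ~~ eigenvalue A z.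
Proof.
rewrite negbK -opprB -scaleN1r unitmxZ ?unitrN1 // -row_free_unit -kermx_eq0.
by [].
Qed.

Lemma resolvent_mulmx n (A : 'M[C]_n) z : ~~ eigenvalue A z ->
  (z%:M - A) *m resolvent A z = 1%:M /\ resolvent A z *m (z%:M - A) = 1%:M.
Proof. by rewrite -unitmx_eigenvalue => u; rewrite mulmxV // mulVmx. Qed.

Lemma resolventB n (A B : 'M[C]_n) z : ~~ eigenvalue A z -> ~~ eigenvalue B z ->
  resolvent B z - resolvent A z = resolvent B z *m (B - A) *m resolvent A z.
Proof.
move=> /resolvent_mulmx[A1 A2] /resolvent_mulmx[B1 B2].
have -> : B - A = (z%:M - A) - (z%:M - B) by rewrite opprB [RHS]addrC subrKA.
by rewrite mulmxBr mulmxBl B2 mul1mx -mulmxA A1 mulmx1.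
Qed.

Lemma eigenvalue_block n (A E : 'M[C]_n) z :
  eigenvalue (block_mx A E 0 A) z -> eigenvalue A z.
Proof.
move=> /eigenvalueP[v vA v0]; apply/eigenvalueP.
rewrite -[v]hsubmxK mul_row_block mulmx0 addr0 scale_row_mx in vA v0.
have [h1 h2] := eq_row_mx vA.
case: (eqVneq (lsubmx v) 0) => [l0|l0]; last by exists (lsubmx v).
exists (rsubmx v); first by rewrite -h2 l0 mul0mx add0r.
by apply: contraNneq v0 => r0; rewrite l0 r0 row_mx0.
Qed.

(** The link between the block matrix and derivatives: the upper right block is the first-order term
    of the resolvent of [A + E]. *)
Lemma resolvent_block n (A E : 'M[C]_n) z : ~~ eigenvalue A z ->
  resolvent (block_mx A E 0 A) z =
  block_mx (resolvent A z) (resolvent A z *m E *m resolvent A z) 0 (resolvent A z).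
Proof.
move=> /resolvent_mulmx[A1 A2]; rewrite /resolvent; apply: (invmx_uniq _).2.
rewrite scalar_mx_block opp_block_mx add_block_mx !oppr0 !add0r mulmx_block.
rewrite !mulmx0 !mul0mx !addr0 !add0r -/(resolvent A z) A1 !mulmxA A1 mul1mx mulNmx subrr.
by rewrite -scalar_mx_block.
Qed.

Variables (n q : nat) (A : 'M[C]_n) (p : 'I_q -> nat) (lam : 'I_q -> C).
Variables (P : 'M[C]_(n, \sum_i p i)) (Q : 'M[C]_(\sum_i p i, n)).
Hypothesis dec : jordan_decomposition A lam P Q.

Lemma resolvent_jordan z : (forall i, z != lam i) -> ~~ eigenvalue A z /\
  resolvent A z =
    \sum_i submxrow P i *m jordan_resolvent (p i) (z - lam i) *m submxcol Q i.
Proof.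
by move=> /(jordan_resolvent_sum dec) /invmx_uniq[]; rewrite unitmx_eigenvalue.
Qed.

(** The entries of the explicit resolvent are 0 or powers [(z - lam i)^-l] with [1 <= l <= p i], so
    the bound holds on the whole unbounded set of such [z], without compactness. Taking [T >= 1]
    makes [T^l] increase with [l]. *)
Lemma resolvent_bounded (r : R) : 0 < r -> exists2 K : R, 0 <= K & forall z,
  (forall i, r <= normc (z - lam i)) -> ~~ eigenvalue A z /\ mnorm (resolvent A z) <= K.
Proof.
move=> r0; pose T := Num.max 1 r^-1; have T1 : 1 <= T by rewrite le_max lexx.
pose K := \sum_i mnorm (submxrow P i) *
  (\sum_(a < p i) \sum_(b < p i) T ^+ p i) * mnorm (submxcol Q i).
have T0 k : 0 <= T ^+ k by rewrite exprn_ge0 // (le_trans ler01).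
exists K => [|z hz].
  apply: sumr_ge0 => i _; rewrite !mulr_ge0 ?mnorm_ge0 //.
  by apply: sumr_ge0 => a _; apply: sumr_ge0.
have [|ev ->] := @resolvent_jordan z.
  by move=> i; rewrite -subr_eq0 -normc_gt0; exact: lt_le_trans (hz i).
split=> //; apply: le_trans (mnorm_sum _ _) _; apply: ler_sum => i _.
apply: le_trans (mnormM _ _) _; rewrite ler_wpM2r ?mnorm_ge0 //.
apply: le_trans (mnormM _ _) _; rewrite ler_wpM2l ?mnorm_ge0 //.
apply: ler_sum => a _; apply: ler_sum => b _; rewrite mxE.
case: leqP => ab; last by rewrite normc0.
have z0 : 0 < normc (z - lam i) by exact: lt_le_trans (hz i).
rewrite normcV normcX -exprVn.
apply: (@le_trans _ _ (T ^+ (b - a).+1)).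
  apply: lerXn2r; rewrite ?nnegrE ?invr_ge0 ?normc_ge0 ?(le_trans ler01) //.
  by rewrite le_max lef_pV2 ?posrE // hz orbT.
apply: ler_weXn2l => //; apply: leq_trans (ltn_ord b).
by rewrite ltnS leq_subr.
Qed.

End Resolvent.

Section MatfunExpansion.
Variable R : realType.
Local Notation C := R[i].
Local Notation normc := (@ComplexField.Normc.normc R).

Section Limit.
Variables (f : R[i]^o -> R[i]^o) (cs : seq C) (r : R).
Variables (nodes : nat -> seq (C * C)) (W : R).
Hypothesis quad : quadrature f cs r nodes W.

Lemma node_neq_near_centers w k p : near_centers cs r w -> p \in nodes k -> p.2 != w.
Proof.
move=> /(near_centers_dist quad)[del del0 [_ h]] /h.
by rewrite -subr_eq0 -normc_gt0; exact: lt_le_trans.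
Qed.

Definition quad_matfun n (A : 'M[C]_n) (k : nat) : 'M[C]_n :=
  \sum_(p <- nodes k) p.1 *: resolvent A p.2.

(** On a Jordan block the entries of the resolvent sums are the [quad_sum]s at its eigenvalue, whose
    limits are the entries of [fun_jordan_block]. The sums do not depend on the decomposition, so
    neither does [B]. *)
Lemma matfun_spec_cvg n (A B : 'M[C]_n) :
  (forall z, eigenvalue A z -> near_centers cs r z) ->
  matfun_spec f A B -> mcvg (quad_matfun A) B.
Proof.
move=> sp [q [p [lam [P [Q [dec ->]]]]]].
have near_lam i : near_centers cs r (lam i) by apply/sp/(jordan_eigenvalue dec).
have -> : quad_matfun A = fun k => \sum_i submxrow P i *m
    (\sum_(x <- nodes k) x.1 *: jordan_resolvent (p i) (x.2 - lam i)) *m submxcol Q i.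
  apply/funext => k; rewrite /quad_matfun.
  under [RHS]eq_bigr => i _ do rewrite mulmx_sumr mulmx_suml.
  rewrite exchange_big /=; apply: eq_big_seq => x xk.
  have xlam i : x.2 != lam i by exact: node_neq_near_centers xk.
  rewrite (resolvent_jordan dec xlam).2 scaler_sumr; apply: eq_bigr => i _.
  by rewrite -scalemxAr -scalemxAl.
rewrite mul_mxdiag_sum; apply: mcvg_sum => i; apply: mcvg_mul => a b.
rewrite mxE; under eq_fun do rewrite summxE.
under eq_fun do under eq_bigr do rewrite !mxE.
case: leqP => ab; last first.
  under eq_fun do under eq_bigr do rewrite mulr0.
  by under eq_fun do rewrite big1_eq; exact: cvg_cst.
have h := @quad_derive1n R f cs r nodes W quad (b - a)%N (lam i) (near_lam i).
exact h.
Qed.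

Lemma matfun_cvg n (A : 'M[C]_n) :
  (forall z, eigenvalue A z -> near_centers cs r z) -> mcvg (quad_matfun A) (matfun f A).
Proof. by move=> h; apply: matfun_spec_cvg h _; exact: matfun_spec_matfun. Qed.

Lemma node_not_eigenvalue n (A : 'M[C]_n) k p :
  (forall z, eigenvalue A z -> near_centers cs r z) -> p \in nodes k -> ~~ eigenvalue A p.2.
Proof.
move=> h pk; apply/negP => /h /node_neq_near_centers/(_ pk); by rewrite eqxx.
Qed.

(** The resolvent sums of the block matrix are block triangular for each [k], so their limit is too,
    whatever the Jordan form of the block matrix. *)
Lemma matfun_block n (A : 'M[C]_n) :
  (forall z, eigenvalue A z -> near_centers cs r z) ->
  exists2 L : 'M[C]_n -> 'M[C]_n,
    (forall E, matfun f (block_mx A E 0 A) = block_mx (matfun f A) (L E) 0 (matfun f A)) &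
    (forall E, mcvg (fun k =>
       \sum_(p <- nodes k) p.1 *: (resolvent A p.2 *m E *m resolvent A p.2)) (L E)).
Proof.
move=> sp.
have spb E z : eigenvalue (block_mx A E 0 A) z -> near_centers cs r z.
  by move=> /eigenvalue_block /sp.
pose S k E := \sum_(p <- nodes k) p.1 *: (resolvent A p.2 *m E *m resolvent A p.2).
have quadE E k : quad_matfun (block_mx A E 0 A) k =
    block_mx (quad_matfun A k) (S k E) 0 (quad_matfun A k).
  rewrite /quad_matfun /S big_seq; under eq_bigr => p pk.
    rewrite resolvent_block; last exact: node_not_eigenvalue pk.
    rewrite scale_block_mx scaler0; over.
  rewrite -big_seq.
  elim: (nodes k) => [|x s IH]; first by rewrite !big_nil block_mx0.
  by rewrite !big_cons IH add_block_mx add0r.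
have hb E := matfun_cvg (spb E).
exists (fun E => ursubmx (matfun f (block_mx A E 0 A))) => E.
  rewrite -[LHS]submxK; congr block_mx.
  - apply: (mcvg_unique _ (matfun_cvg sp)) => a b.
    have := hb E (lshift n a) (lshift n b); rewrite !mxE.
    by under eq_fun do rewrite quadE block_mxEul.
  - apply: (mcvg_unique (X := fun=> 0)) => [a b|a b]; last exact: cvg_cst.
    have := hb E (rshift n a) (lshift n b).
    rewrite !mxE; under eq_fun do rewrite quadE block_mxEdl mxE.
    exact.
  - apply: (mcvg_unique _ (matfun_cvg sp)) => a b.
    have := hb E (rshift n a) (rshift n b); rewrite !mxE.
    by under eq_fun do rewrite quadE block_mxEdr.
move=> a b; have := hb E (lshift n a) (rshift n b); rewrite !mxE.
by under eq_fun do rewrite quadE block_mxEur.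
Qed.

End Limit.

Lemma mulmx_delta_sum m n p q (X : 'M[C]_(m, n)) (E : 'M[C]_(n, p)) (Y : 'M[C]_(p, q)) a b :
  (X *m E *m Y) a b = \sum_c \sum_d (X *m delta_mx c d *m Y) a b * E c d.
Proof.
rewrite {1}[E]matrix_sum_delta mulmx_sumr mulmx_suml summxE; apply: eq_bigr => c _.
rewrite mulmx_sumr mulmx_suml summxE; apply: eq_bigr => d _.
by rewrite -scalemxAr -scalemxAl mxE mulrC.
Qed.

(** For [B] near [A] the same nodes serve both matrices. With [D = B - A] and [RA], [RB] the
    resolvents, applying the resolvent identity twice leaves at each node the remainder
    [RB D RA D RA], of second order. *)
Lemma matfun_expansion (f : R[i]^o -> R[i]^o) (Omega : set R[i]^o) n (A : 'M[C]_n) :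
  open Omega -> (forall z, Omega z -> derivable f z 1) ->
  (forall z, Omega z -> {for z, continuous (derive1 f)}) ->
  (forall z, eigenvalue A z -> Omega z) ->
  exists (l : 'I_n -> 'I_n -> 'I_n -> 'I_n -> C) (eta K : R),
  [/\ 0 < eta, 0 <= K,
    forall E, matfun f (block_mx A E 0 A) =
      block_mx (matfun f A) (\matrix_(a, b) \sum_c \sum_d l a b c d * E c d) 0 (matfun f A) &
    forall B, mnorm (B - A) < eta -> forall a b,
      normc (matfun f B a b - matfun f A a b - \sum_c \sum_d l a b c d * (B - A) c d)
        <= K * mnorm (B - A) ^+ 2].
Proof.
move=> Oo fD f'C AO.
have [q [p [lam [P [Q dec]]]]] := jordan_decomposition_exists A.
have lamO c : c \in codom lam -> Omega c.
  by move=> /codomP[i ->]; apply/AO/(jordan_eigenvalue dec).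
have [r [nodes [W quad]]] := quadrature_exists Oo fD f'C lamO.
have r0 := quad_radius quad.
have [K K0 hK] := resolvent_bounded dec r0.
have evA z : eigenvalue A z -> near_centers (codom lam) r z.
  move=> ev; apply: contrapT => far.
  have h i : r <= normc (z - lam i).
    by rewrite leNgt; apply/negP => zi; apply: far; exists (lam i) => //; exact: codom_f.
  by case: (hK z h) => /negP.
have [L Lblock Lcvg] := matfun_block quad evA.
pose S k E := \sum_(p <- nodes k) p.1 *: (resolvent A p.2 *m E *m resolvent A p.2).
have W0 : 0 <= W.
  by apply: le_trans (quad_weight quad 0) => //; apply: sumr_ge0 => x _; exact: normc_ge0.
(* [L] is a limit of the linear maps [S k], hence linear; its values on elementary matrices are the
   coefficients [l]. *)
have LE E a b : L E a b = \sum_c \sum_d L (delta_mx c d) a b * E c d.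
  have h : (fun k => \sum_c \sum_d S k (delta_mx c d) a b * E c d : R[i]^o) @ \oo -->
      (\sum_c \sum_d L (delta_mx c d) a b * E c d : R[i]^o).
    apply: cvg_normc_sum => c; apply: cvg_normc_sum => d.
    under eq_fun do rewrite mulrC; rewrite mulrC.
    by apply: cvg_normcMl; exact: Lcvg.
  apply: cvg_normc_unique (Lcvg E a b) _.
  have SE k : S k E a b = \sum_c \sum_d S k (delta_mx c d) a b * E c d.
    rewrite /S summxE; under eq_bigr => x _ do rewrite mxE mulmx_delta_sum mulr_sumr.
    rewrite exchange_big; apply: eq_bigr => c _.
    under eq_bigr => x _ do rewrite mulr_sumr.
    rewrite exchange_big; apply: eq_bigr => d _.
    rewrite summxE mulr_suml; apply: eq_bigr => x _.
    by rewrite [in RHS]mxE mulrA.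
  by under eq_fun do rewrite -/(S _ E) SE.
have node_far k x : x \in nodes k -> forall i, r <= normc (x.2 - lam i).
  by move=> xk i; apply: (quad_dist quad xk); exact: codom_f.
(* This [eta] forces [mnorm (B - A) * K <= 1 / 2], whence the bound [2 K] on the resolvent of [B].
   The other two factors [K] bound the resolvents of [A] in the remainder, and [W] the weights. *)
exists (fun a b c d => L (delta_mx c d) a b), (2 * (K + 1))^-1, (W * (2 * K * K * K)).
have K1 : 0 < 2 * (K + 1) by rewrite mulr_gt0 // ltr_wpDl.
split; first by rewrite invr_gt0.
- by rewrite !mulr_ge0.
- move=> E; rewrite Lblock; congr block_mx.
  by apply/matrixP => a b; rewrite LE mxE.
move=> B hB a b; rewrite -LE.
have BK : mnorm (B - A) * K <= 1 / 2.
  have m0 := mnorm_ge0 (B - A).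
  move: hB; rewrite -[X in _ < X]mul1r ltr_pdivlMr //; nra.
have farB z : (forall i, r <= normc (z - lam i)) -> ~~ eigenvalue B z.
  move=> /hK[Az Kz]; apply/negP => /eigenvalueP[v vB v0].
  have E : v = v *m (B - A) *m resolvent A z.
    have [h _] := resolvent_mulmx Az.
    rewrite -[LHS]mulmx1 -h mulmxA; congr (_ *m _).
    by rewrite !mulmxBr mul_mx_scalar vB.
  have h1 : mnorm v <= mnorm v * (1 / 2).
    rewrite {1}E; apply: le_trans (mnormM _ _) _.
    apply: le_trans (ler_wpM2r (mnorm_ge0 _) (mnormM _ _)) _.
    rewrite -mulrA ler_wpM2l ?mnorm_ge0 //; apply: le_trans BK.
    by rewrite ler_wpM2l ?mnorm_ge0.
  case/eqP: v0; apply: mnorm_eq0; have := mnorm_ge0 v; lra.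
have evB z : eigenvalue B z -> near_centers (codom lam) r z.
  move=> ev; apply: contrapT => far.
  have h i : r <= normc (z - lam i).
    by rewrite leNgt; apply/negP => zi; apply: far; exists (lam i) => //; exact: codom_f.
  by move/negP: (farB z h).
(* No Neumann series: invertibility is already known, so the resolvent identity gives
   [x <= x / 2 + K] for the norm [x]. *)
have resB z : (forall i, r <= normc (z - lam i)) -> mnorm (resolvent B z) <= 2 * K.
  move=> hz; have [Az Kz] := hK z hz; have Bz := farB z hz.
  have := resolventB Az Bz => /eqP; rewrite subr_eq => /eqP E.
  have : mnorm (resolvent B z) <= mnorm (resolvent B z) * (1 / 2) + K.
    rewrite {1}E; apply: le_trans (mnormD _ _) _; apply: lerD => //.
    apply: le_trans (mnormM _ _) _.
    apply: le_trans (ler_wpM2r (mnorm_ge0 _) (mnormM _ _)) _.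
    rewrite -mulrA ler_wpM2l ?mnorm_ge0 //; apply: le_trans BK.
    by rewrite ler_wpM2l ?mnorm_ge0.
  lra.
have lim : (fun k =>
    quad_matfun nodes B k a b + (- quad_matfun nodes A k a b) + (- S k (B - A) a b) : R[i]^o)
    @ \oo --> (matfun f B a b + (- matfun f A a b) + (- L (B - A) a b) : R[i]^o).
  apply: cvgD; last by apply: cvgN; exact: Lcvg.
  by apply: cvgD; [exact: (matfun_cvg quad evB)|apply: cvgN; exact: (matfun_cvg quad evA)].
apply: cvg_normc_le lim _; apply: nearW => k.
pose g z := (resolvent B z *m (B - A) *m resolvent A z *m (B - A) *m resolvent A z) a b.
have -> : quad_matfun nodes B k a b - quad_matfun nodes A k a b - S k (B - A) a b =
  \sum_(x <- nodes k) x.1 * g x.2.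
  rewrite /quad_matfun /S !summxE -!sumrB; apply: eq_big_seq => x xk.
  have xr := node_far k x xk; have [Az _] := hK _ xr; have Bz := farB _ xr.
  have scal (y : C) (M : 'M[C]_n) : (y *: M) a b = y * M a b by rewrite mxE.
  have subE (M N : 'M[C]_n) : M a b - N a b = (M - N) a b by rewrite !mxE.
  rewrite !scal -!mulrBr !subE; congr (_ * (_ : 'M[C]_n) a b).
  by rewrite (resolventB Az Bz) -!mulmxBl (resolventB Az Bz).
rewrite -mulrA; apply: (quad_bound quad (g := g)) => [|x xk].
  by apply: mulr_ge0; [rewrite !mulr_ge0|rewrite exprn_ge0 // mnorm_ge0].
have xr := node_far k x xk; have [_ Kx] := hK _ xr; have Bx := resB _ xr.
apply: le_trans (mnorm_entry _ _ _) _.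
have step m1 (X : 'M[C]_n) (Y : 'M[C]_n) (s t : R) : 0 <= s -> mnorm X <= s -> mnorm Y <= t ->
    m1 = s * t -> mnorm (X *m Y) <= m1.
  move=> s0 Xs Yt ->; apply: le_trans (mnormM _ _) _.
  by apply: ler_pM => //; exact: mnorm_ge0.
have D0 := mnorm_ge0 (B - A); set D := mnorm (B - A) in D0 *.
have K20 : 0 <= 2 * K by rewrite mulr_ge0.
have K2D0 : 0 <= 2 * K * D by rewrite mulr_ge0.
have K2DK0 : 0 <= 2 * K * D * K by rewrite mulr_ge0.
apply: (@step _ _ _ (2 * K * D * K * D) K) => //; first by rewrite mulr_ge0.
  apply: (@step _ _ _ (2 * K * D * K) D) => //.
  apply: (@step _ _ _ (2 * K * D) K) => //.
  exact: (@step _ _ _ (2 * K) D).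
by ring.
Qed.

End MatfunExpansion.

(** * Differentiability in several real variables *)

Section Differentiability.
Variable R : realType.
Local Notation C := R[i].
Local Notation normc := (@ComplexField.Normc.normc R).

Section NormedDomain.
Variable V : normedModType R.
Implicit Types (u : V -> R) (x : V).

Definition flat_at u x := forall e : R, 0 < e -> \forall y \near x, `|u y| <= e * `|y - x|.

Lemma flat_at_is_diff u x : flat_at u x -> is_diff x u (0 : V -> R).
Proof.
move=> fl.
have ux : u x = 0.
  apply/normr0_eq0/eqP; rewrite eq_le normr_ge0 andbT.
  by have := nbhs_singleton (fl 1 ltr01); rewrite subrr normr0 mulr0.
have E : u \o shift x = cst (u x) + (\0 : V -> R) +o_ 0 id.
  apply/eqaddoP => e e0; have := fl e e0; rewrite (near_shift 0) subr0.
  apply: filterS => y /=; rewrite addrK.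
  by rewrite /= !fctE ux (_ : GRing.null_fun _ y = 0) // addr0 subr0.
have dE : 'd u x = \0 :> (V -> R).
  by apply: diff_unique E; exact: cst_continuous.
apply: DiffDef => //; apply/diff_locallyP; rewrite dE; split => //; exact: cst_continuous.
Qed.

(** By the product rule the differential of the square is a multiple of [u x], which is 0. *)
Lemma flat_at_sqr u x : differentiable u x -> u x = 0 -> flat_at (fun y => u y ^+ 2) x.
Proof.
move=> du ux e e0.
have h := is_diffM (differentiableP du) (differentiableP du).
have /diff_locally := @ex_diff _ _ _ _ _ _ _ h.
rewrite (@diff_val _ _ _ _ _ _ _ h) ux !scale0r addr0 => /eqaddoP/(_ e e0) hu.
have H : \forall h \near (0 : V), `|u (h + x) ^+ 2| <= e * `|h|.
  by apply: filterS hu => y; rewrite /= !fctE ux mul0r addr0 subr0 expr2.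
move: H; rewrite (near_shift x) sub0r; apply: filterS => y /=.
by rewrite subrK.
Qed.

Lemma flat_at_sum (I : Type) (s : seq I) (u : I -> V -> R) x :
  (forall i, flat_at (u i) x) -> flat_at (fun y => \sum_(i <- s) u i y) x.
Proof.
move=> h; elim: s => [|i s IH] e e0.
  by apply: nearW => y; rewrite big_nil normr0 mulr_ge0 // ltW.
have e20 : 0 < e / 2 by rewrite divr_gt0.
apply: filterS2 (h i _ e20) (IH _ e20) => y h1 h2; rewrite big_cons.
by apply: le_trans (ler_normD _ _) _; rewrite [e]splitr mulrDl lerD.
Qed.

Lemma flat_at_le u w x K : flat_at w x -> (\forall y \near x, `|u y| <= K * `|w y|) -> flat_at u x.
Proof.
move=> fl h e e0; pose K' := `|K| + 1.
have K'0 : 0 < K' by rewrite ltr_wpDl.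
apply: filterS2 h (fl _ (divr_gt0 e0 K'0)) => y h1 h2; apply: le_trans h1 _.
apply: le_trans (_ : _ <= K' * `|w y|) _.
  by rewrite ler_wpM2r // (le_trans (ler_norm K)) // lerDl.
apply: le_trans (ler_wpM2l (ltW K'0) h2) _.
by rewrite mulrA mulrCA mulfV ?gt_eqF // mulr1.
Qed.

Lemma is_diff_sum (I : Type) (s : seq I) (u du : I -> V -> R) x :
  (forall i, is_diff x (u i) (du i)) ->
  is_diff x (fun y => \sum_(i <- s) u i y) (fun v => \sum_(i <- s) du i v).
Proof.
move=> h; elim: s => [|i s IH].
  have -> : (fun y => \sum_(i <- [::]) u i y) = cst 0 by apply/funext => y; rewrite big_nil.
  have -> : (fun y => \sum_(i <- [::]) du i y) = 0 by apply/funext => y; rewrite big_nil.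
  exact: is_diff_cst.
have -> : (fun y => \sum_(i <- i :: s) u i y) = u i + (fun y => \sum_(i <- s) u i y).
  by apply/funext => y; rewrite big_cons.
have -> : (fun y => \sum_(i <- i :: s) du i y) = du i + (fun y => \sum_(i <- s) du i y).
  by apply/funext => y; rewrite big_cons.
exact: is_diffD.
Qed.

End NormedDomain.

Variable j : nat.

Definition mx_differentiable n (A : 'rV[R]_j -> 'M[C]_n) (x : 'rV[R]_j) : Prop :=
  forall a b, differentiable (fun y => complex.Re (A y a b)) x /\
              differentiable (fun y => complex.Im (A y a b)) x.

Lemma ReM (z w : C) :
  complex.Re (z * w) = complex.Re z * complex.Re w - complex.Im z * complex.Im w.
Proof. by case: z; case: w. Qed.

Lemma ImM (z w : C) :
  complex.Im (z * w) = complex.Im z * complex.Re w + complex.Re z * complex.Im w.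
Proof. by case: z => a b; case: w => c d /=; rewrite addrC. Qed.

Lemma ReD (z w : C) : complex.Re (z + w) = complex.Re z + complex.Re w.
Proof. by case: z; case: w. Qed.

Lemma ImD (z w : C) : complex.Im (z + w) = complex.Im z + complex.Im w.
Proof. by case: z; case: w. Qed.

Lemma ReB (z w : C) : complex.Re (z - w) = complex.Re z - complex.Re w.
Proof. by case: z; case: w. Qed.

Lemma ImB (z w : C) : complex.Im (z - w) = complex.Im z - complex.Im w.
Proof. by case: z; case: w. Qed.

Lemma Re_sum (I : Type) (s : seq I) (F : I -> C) :
  complex.Re (\sum_(i <- s) F i) = \sum_(i <- s) complex.Re (F i).
Proof. by elim/big_rec2: _ => // i x y _ <-; rewrite ReD. Qed.

Lemma Im_sum (I : Type) (s : seq I) (F : I -> C) :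
  complex.Im (\sum_(i <- s) F i) = \sum_(i <- s) complex.Im (F i).
Proof. by elim/big_rec2: _ => // i x y _ <-; rewrite ImD. Qed.

Lemma mx_differentiable_near n (A : 'rV[R]_j -> 'M[C]_n) x (eta : R) :
  mx_differentiable A x -> 0 < eta -> \forall y \near x, mnorm (A y - A x) < eta.
Proof.
move=> dA eta0.
(* Each of the [n * n] entries contributes at most [2 e]; the extra 1 makes the total strictly
   smaller than [eta] and covers [n = 0]. *)
pose e := eta / ((n * n).*2.+1)%:R.
have e0 : 0 < e by rewrite divr_gt0.
have h a b : \forall y \near x, normc ((A y - A x) a b) <= e + e.
  have [/differentiable_continuous/cvgrPdist_le/(_ _ e0) h1
    /differentiable_continuous/cvgrPdist_le/(_ _ e0) h2] := dA a b.
  apply: filterS2 h1 h2 => y h1 h2; apply: le_trans (normc_le_ReIm _) _.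
  by rewrite !mxE ReB ImB; apply: lerD; rewrite distrC.
have : \forall y \near x, forall a b, normc ((A y - A x) a b) <= e + e.
  pose P a b := [set y | normc ((A y - A x) a b) <= e + e].
  apply: (@filter_forall _ _ (fun a => [set y | forall b, P a b y]) _ (nbhs_filter x)) => a.
  exact: (@filter_forall _ _ (P a) _ (nbhs_filter x) (h a)).
apply: filterS => y hy.
apply: le_lt_trans (_ : (\sum_(a < n) \sum_(b < n) (e + e)) < eta).
  by apply: ler_sum => a _; apply: ler_sum => b _.
rewrite !sumr_const !card_ord -mulrnA -mulr2n -mulrnA mul2n -mulr_natr /e.
by rewrite mulrAC ltr_pdivrMr ?ltr0n // ltr_pM2l // ltr_nat.
Qed.

(** The square of the sum of moduli is a double sum of products [X p * X q], each at most
    [X p ^+ 2 + X q ^+ 2]; these squares are sums of squares of real functions that vanish and are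
    differentiable at [x]. *)
Lemma mx_differentiable_flat n (A : 'rV[R]_j -> 'M[C]_n) x :
  mx_differentiable A x -> flat_at (fun y => mnorm (A y - A x) ^+ 2) x.
Proof.
move=> dA.
pose w (p : 'I_n * 'I_n) y := (complex.Re (A y p.1 p.2 - A x p.1 p.2)) ^+ 2 +
  (complex.Im (A y p.1 p.2 - A x p.1 p.2)) ^+ 2.
have wfl p : flat_at (w p) x.
  have [d1 d2] := dA p.1 p.2.
  have f1 : flat_at (fun y => complex.Re (A y p.1 p.2 - A x p.1 p.2) ^+ 2) x.
    apply: (flat_at_sqr (u := fun y => complex.Re (A y p.1 p.2 - A x p.1 p.2)));
      last by rewrite subrr.
    under eq_fun do rewrite ReB.
    exact: (differentiableB d1 (differentiable_cst (complex.Re (A x p.1 p.2)) x)).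
  have f2 : flat_at (fun y => complex.Im (A y p.1 p.2 - A x p.1 p.2) ^+ 2) x.
    apply: (flat_at_sqr (u := fun y => complex.Im (A y p.1 p.2 - A x p.1 p.2)));
      last by rewrite subrr.
    under eq_fun do rewrite ImB.
    exact: (differentiableB d2 (differentiable_cst (complex.Im (A x p.1 p.2)) x)).
  move=> e e0; have e20 : 0 < e / 2 by rewrite divr_gt0.
  apply: filterS2 (f1 _ e20) (f2 _ e20) => y h1 h2; rewrite /w.
  by apply: le_trans (ler_normD _ _) _; rewrite [e]splitr mulrDl lerD.
have ww p q : flat_at (fun y => w p y + w q y) x.
  move=> e e0; have e20 : 0 < e / 2 by rewrite divr_gt0.
  apply: filterS2 (wfl p _ e20) (wfl q _ e20) => y h1 h2.
  by apply: le_trans (ler_normD _ _) _; rewrite [e]splitr mulrDl lerD.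
have fl := flat_at_sum (index_enum _) (fun p => flat_at_sum (index_enum _) (ww p)).
apply: (flat_at_le (K := 1) fl); apply: (@filterE _ (nbhs x) (nbhs_filter x)) => y.
rewrite mul1r.
rewrite /mnorm pair_big /= expr2 mulr_suml.
pose X p := normc ((A y - A x) p.1 p.2).
have X0 p : 0 <= X p by exact: normc_ge0.
have XE p : X p ^+ 2 = w p y.
  rewrite /X /w mxE [(- A x) _ _]mxE; case: (A y p.1 p.2 - A x p.1 p.2) => s t.
  by rewrite /ComplexField.Normc.normc sqr_sqrtr // addr_ge0 ?sqr_ge0.
rewrite !ger0_norm; first 1 last.
- by apply: sumr_ge0 => p _; apply: sumr_ge0 => q _; rewrite addr_ge0 // -XE sqr_ge0.
- by apply: sumr_ge0 => p _; rewrite mulr_ge0 //; [exact: X0|apply: sumr_ge0 => q _; exact: X0].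
apply: ler_sum => p _; rewrite mulr_sumr; apply: ler_sum => q _.
rewrite -!XE -/(X p) -/(X q).
have := X0 p; have := X0 q; nra.
Qed.


End Differentiability.

Section MatfunDifferentiable.
Variable R : realType.
Local Notation C := R[i].
Local Notation normc := (@ComplexField.Normc.normc R).
Variables (j : nat) (f : R[i]^o -> R[i]^o) (Omega : set R[i]^o).
Hypothesis Oopen : open Omega.
Hypothesis fD : forall z, Omega z -> derivable f z 1.
Hypothesis f'C : forall z, Omega z -> {for z, continuous (derive1 f)}.

Lemma is_diff_combination (V : normedModType R) (n : nat) (s t : 'I_n -> 'I_n -> R)
    (u w : 'I_n -> 'I_n -> V -> R) (g rho : V -> R) (k : R) (x : V) :
  (forall c d, differentiable (u c d) x) -> (forall c d, differentiable (w c d) x) ->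
  flat_at rho x ->
  (forall y, g y = \sum_c \sum_d (s c d * u c d y + t c d * w c d y) + (k + rho y)) ->
  is_diff x g (fun v => \sum_c \sum_d (s c d * 'd (u c d) x v + t c d * 'd (w c d) x v)).
Proof.
move=> du dw fl gE.
have lin : is_diff x (fun y => \sum_c \sum_d (s c d * u c d y + t c d * w c d y))
    (fun v => \sum_c \sum_d (s c d * 'd (u c d) x v + t c d * 'd (w c d) x v)).
  apply: is_diff_sum => c; apply: is_diff_sum => d.
  exact: (is_diffD (is_diffZ (s c d) (differentiableP (du c d)))
                   (is_diffZ (t c d) (differentiableP (dw c d)))).
have h := is_diffD lin (is_diffD (is_diff_cst k x) (flat_at_is_diff fl)).
have -> : g = (fun y => \sum_c \sum_d (s c d * u c d y + t c d * w c d y)) + (cst k + rho).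
  by apply/funext => y; rewrite gE.
rewrite [X in is_diff _ _ X](_ : _ =
  (fun v => \sum_c \sum_d (s c d * 'd (u c d) x v + t c d * 'd (w c d) x v)) + (0 + 0)) //.
by rewrite !addr0.
Qed.

(** Both claims come from one expansion: the coefficients [l] of the linear term of [matfun f] at
    [A x] are also those of the upper right block. Composing with the differential of [A], in real
    and imaginary parts, identifies the partial derivatives with that block. *)
Lemma matfun_differentiable n (A : 'rV[R]_j -> 'M[C]_n) (x : 'rV[R]_j) :
  mx_differentiable A x -> (forall z, eigenvalue (A x) z -> Omega z) ->
  mx_differentiable (fun y => matfun f (A y)) x /\
  forall i, matfun f (block_mx (A x) (mx_partial i A x) 0 (A x)) =
    block_mx (matfun f (A x)) (mx_partial i (fun y => matfun f (A y)) x) 0 (matfun f (A x)).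
Proof.
move=> dA AO; have [l [eta [K [eta0 K0 Lblock Lexp]]]] := matfun_expansion Oopen fD f'C AO.
pose G y := matfun f (A y).
pose rho a b y := G y a b - G x a b - \sum_c \sum_d l a b c d * (A y - A x) c d.
have rho_small a b : \forall y \near x, normc (rho a b y) <= K * mnorm (A y - A x) ^+ 2.
  by apply: filterS (mx_differentiable_near dA eta0) => y hy; exact: Lexp.
have fl := mx_differentiable_flat dA.
have reFlat a b : flat_at (fun y => complex.Re (rho a b y)) x.
  apply: (flat_at_le (K := K) fl); apply: filterS (rho_small a b) => y hy.
  rewrite (ger0_norm (sqr_ge0 _)); exact: le_trans (normRe_le _) hy.
have imFlat a b : flat_at (fun y => complex.Im (rho a b y)) x.
  apply: (flat_at_le (K := K) fl); apply: filterS (rho_small a b) => y hy.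
  rewrite (ger0_norm (sqr_ge0 _)); exact: le_trans (normIm_le _) hy.
have GE y a b : G y a b = G x a b + \sum_c \sum_d l a b c d * (A y - A x) c d + rho a b y.
  by rewrite /rho; ring.
pose u c d y := complex.Re (A y c d); pose w c d y := complex.Im (A y c d).
have du c d : differentiable (u c d) x by case: (dA c d).
have dw c d : differentiable (w c d) x by case: (dA c d).
have reDiff a b : is_diff x (fun y => complex.Re (G y a b))
    (fun v => \sum_c \sum_d (complex.Re (l a b c d) * 'd (u c d) x v
                             + (- complex.Im (l a b c d)) * 'd (w c d) x v)).
  apply: (is_diff_combination (rho := fun y => complex.Re (rho a b y))
    (k := complex.Re (G x a b) - \sum_c \sum_d (complex.Re (l a b c d) * u c d x
                             + (- complex.Im (l a b c d)) * w c d x)) du dw (reFlat a b)) => y.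
  rewrite GE !ReD Re_sum.
  have -> : \sum_c complex.Re (\sum_d l a b c d * (A y - A x) c d) =
    \sum_c \sum_d (complex.Re (l a b c d) * u c d y + (- complex.Im (l a b c d)) * w c d y)
    - \sum_c \sum_d (complex.Re (l a b c d) * u c d x + (- complex.Im (l a b c d)) * w c d x).
    rewrite -sumrB; apply: eq_bigr => c _; rewrite Re_sum -sumrB; apply: eq_bigr => d _.
    by rewrite ReM !mxE ReB ImB /u /w; ring.
  by ring.
have imDiff a b : is_diff x (fun y => complex.Im (G y a b))
    (fun v => \sum_c \sum_d (complex.Im (l a b c d) * 'd (u c d) x v
                             + complex.Re (l a b c d) * 'd (w c d) x v)).
  apply: (is_diff_combination (rho := fun y => complex.Im (rho a b y))
    (k := complex.Im (G x a b) - \sum_c \sum_d (complex.Im (l a b c d) * u c d x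
                             + complex.Re (l a b c d) * w c d x)) du dw (imFlat a b)) => y.
  rewrite GE !ImD Im_sum.
  have -> : \sum_c complex.Im (\sum_d l a b c d * (A y - A x) c d) =
    \sum_c \sum_d (complex.Im (l a b c d) * u c d y + complex.Re (l a b c d) * w c d y)
    - \sum_c \sum_d (complex.Im (l a b c d) * u c d x + complex.Re (l a b c d) * w c d x).
    rewrite -sumrB; apply: eq_bigr => c _; rewrite Im_sum -sumrB; apply: eq_bigr => d _.
    by rewrite ImM !mxE ReB ImB /u /w; ring.
  by ring.
split=> [a b|i].
  by split; [exact: (@ex_diff _ _ _ _ _ _ _ (reDiff a b))
            |exact: (@ex_diff _ _ _ _ _ _ _ (imDiff a b))].
rewrite Lblock; congr block_mx; apply/matrixP => a b; rewrite !mxE.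
have dre c d : 'D_(delta_mx 0 i) (u c d) x = 'd (u c d) x (delta_mx 0 i) by exact: deriveE.
have dim c d : 'D_(delta_mx 0 i) (w c d) x = 'd (w c d) x (delta_mx 0 i) by exact: deriveE.
apply/eqP; rewrite eq_complex; apply/andP; split; apply/eqP => /=.
  rewrite /partial deriveE; last exact: (@ex_diff _ _ _ _ _ _ _ (reDiff a b)).
  rewrite (@diff_val _ _ _ _ _ _ _ (reDiff a b)) Re_sum; apply: eq_bigr => c _.
  rewrite Re_sum; apply: eq_bigr => d _.
  by rewrite mxE ReM /= /partial dre dim mulNr.
rewrite /partial deriveE; last exact: (@ex_diff _ _ _ _ _ _ _ (imDiff a b)).
rewrite (@diff_val _ _ _ _ _ _ _ (imDiff a b)) Im_sum; apply: eq_bigr => c _.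
rewrite Im_sum; apply: eq_bigr => d _.
by rewrite mxE ImM /= /partial dre dim.
Qed.

End MatfunDifferentiable.

(** * Higher differentiability of real functions *)

Section KDifferentiable.
Variables (R : realType) (j : nat).
Local Notation C := R[i].
Implicit Types (g h : 'rV[R]_j -> R) (x : 'rV[R]_j).

Lemma near_near (P : 'rV[R]_j -> Prop) x :
  (\forall y \near x, P y) -> \forall y \near x, \forall z \near y, P z.
Proof. by move=> /nbhs_interior. Qed.

Lemma partial_near (i : 'I_j) g h x :
  (\forall y \near x, g y = h y) -> partial i g x = partial i h x.
Proof. by move=> gh; apply: near_eq_derive. Qed.

Lemma foldr_partial_near (s : seq 'I_j) g h x : (\forall y \near x, g y = h y) ->
  \forall y \near x, foldr (@partial R j) g s y = foldr (@partial R j) h s y.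
Proof.
elim: s => [|i s IH] //= gh.
by apply: filterS (near_near (IH gh)) => y; exact: partial_near.
Qed.

Lemma near_differentiable g h x :
  (\forall y \near x, g y = h y) -> differentiable g x -> differentiable h x.
Proof.
move=> gh dg; have fl : flat_at (h - g) x.
  move=> e e0; apply: filterS gh => y E.
  by rewrite !fctE E subrr normr0 mulr_ge0 // ltW.
have := @ex_diff _ _ _ _ _ _ _ (is_diffD (differentiableP dg) (flat_at_is_diff fl)).
by rewrite addrC subrK.
Qed.

Lemma k_differentiable_near k g h x :
  (\forall y \near x, g y = h y) -> k_differentiable k g x -> k_differentiable k h x.
Proof.
elim: k x => [|k IH] x gh //= [g1 g2]; split.
  by apply: filterS2 (near_near gh) g1 => y; exact: IH.
by move=> s; apply: near_differentiable (foldr_partial_near s gh) (g2 s).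
Qed.

Lemma k_differentiable_pred k g x : k_differentiable k.+1 g x -> k_differentiable k g x.
Proof. by case=> /nbhs_singleton. Qed.

Lemma k_differentiable_le k l g x : (k <= l)%N -> k_differentiable l g x -> k_differentiable k g x.
Proof.
move=> /subnK <-; elim: (l - k)%N => [|p IH] //.
by rewrite addSn => /k_differentiable_pred.
Qed.

Lemma k_differentiable1 g x : k_differentiable 1 g x <-> differentiable g x.
Proof.
split=> [[_ /(_ [tuple])]|dg] //; split; first exact: (@filterE _ (nbhs x) (nbhs_filter x)).
by move=> s; rewrite tuple0.
Qed.

Lemma k_differentiable_partial k i g x :
  k_differentiable k.+1 g x -> k_differentiable k (partial i g) x.
Proof.
elim: k x => [|k IH] x // [g1 g2]; split.
  by apply: filterS g1 => y; exact: IH.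
by move=> s; have := g2 [tuple of rcons s i]; rewrite foldr_rcons.
Qed.

(** Converse to [k_differentiable_partial]. For [k = 0] differentiability is required at [x] only,
    which is why the neighborhood condition is restricted to [0 < k]. *)
Lemma k_differentiableS k g x :
  differentiable g x -> ((0 < k)%N -> \forall y \near x, differentiable g y) ->
  (forall i, k_differentiable k (partial i g) x) -> k_differentiable k.+1 g x.
Proof.
elim: k x => [|k IH] x dg dgn dp; first exact/k_differentiable1.
split.
  have dp1 : \forall y \near x, forall i, k_differentiable k (partial i g) y.
    apply: (@filter_forall _ _ (fun i => [set y | k_differentiable k (partial i g) y])
      _ (nbhs_filter x)) => i.
    by case: (dp i).
  have := dgn isT => dg1.
  have dg2 := near_near dg1.
  apply: filterS (filterI dp1 (filterI dg1 dg2)) => y [p1 [p2 p3]].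
  exact: IH.
move=> s; case/tupleP: s => i0 s0.
(* [foldr] applies the last direction first, so the list is split at its end to expose a derivative
   of [partial i g]. *)
have -> : (cons_tuple i0 s0 : seq _) = rcons (belast i0 s0) (last i0 s0) by rewrite /= lastI.
rewrite foldr_rcons; have [_ /(_ [tuple of belast i0 s0])] := dp (last i0 s0).
exact.
Qed.

Lemma k_differentiable_cst k (c : R) x : k_differentiable k (fun=> c) x.
Proof.
elim: k c x => [|k IH] c x //.
have pc (i : 'I_j) : partial i (fun=> c) = fun=> 0.
  by apply/funext => y; rewrite /partial derive_cst.
apply: k_differentiableS => [|_|i].
- exact: differentiable_cst.
- by apply: (@filterE _ (nbhs x) (nbhs_filter x)) => y; exact: (differentiable_cst c y).
by rewrite pc.
Qed.

End KDifferentiable.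

Section MatrixKDifferentiable.
Variables (R : realType) (j : nat).
Local Notation C := R[i].

Lemma mx_near_forall n (P : 'I_n -> 'I_n -> 'rV[R]_j -> Prop) (x : 'rV[R]_j) :
  (forall a b, \forall y \near x, P a b y) -> \forall y \near x, forall a b, P a b y.
Proof.
move=> h; apply: (@filter_forall _ _ (fun a => [set y | forall b, P a b y]) _ (nbhs_filter x)) => a.
exact: (@filter_forall _ _ (P a) _ (nbhs_filter x) (h a)).
Qed.

Lemma mx_k_differentiable_near n k (G H : 'rV[R]_j -> 'M[C]_n) x :
  (\forall y \near x, G y = H y) -> mx_k_differentiable k G x -> mx_k_differentiable k H x.
Proof.
move=> GH dG a b; have [d1 d2] := dG a b.
by split; [apply: k_differentiable_near d1|apply: k_differentiable_near d2];
  apply: filterS GH => y ->.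
Qed.

Lemma mx_partial_near n i (G H : 'rV[R]_j -> 'M[C]_n) x :
  (\forall y \near x, G y = H y) -> mx_partial i G x = mx_partial i H x.
Proof.
move=> GH; apply/matrixP => a b; rewrite !mxE.
by congr (_ +i* _); apply: partial_near; apply: filterS GH => y ->.
Qed.

Lemma mx_k_differentiable_pred n k (G : 'rV[R]_j -> 'M[C]_n) x :
  mx_k_differentiable k.+1 G x -> mx_k_differentiable k G x.
Proof. by move=> dG a b; have [d1 d2] := dG a b; split; exact: k_differentiable_pred. Qed.

Lemma mx_k_differentiable_nbhs n k (G : 'rV[R]_j -> 'M[C]_n) x :
  mx_k_differentiable k.+1 G x -> \forall y \near x, mx_k_differentiable k G y.
Proof.
move=> dG; apply: mx_near_forall => a b; have [[d1 _] [d2 _]] := dG a b.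
by apply: filterS2 d1 d2.
Qed.

Lemma mx_k_differentiable_partial n k i (G : 'rV[R]_j -> 'M[C]_n) x :
  mx_k_differentiable k.+1 G x -> mx_k_differentiable k (mx_partial i G) x.
Proof.
move=> dG a b; have [/(k_differentiable_partial i) d1 /(k_differentiable_partial i) d2] := dG a b.
by split; [move: d1|move: d2]; congr k_differentiable; apply/funext => y; rewrite mxE.
Qed.

Lemma mx_k_differentiable1 n k (G : 'rV[R]_j -> 'M[C]_n) x :
  mx_k_differentiable k.+1 G x -> mx_differentiable G x.
Proof.
move=> dG a b; have [d1 d2] := dG a b.
by split; apply/k_differentiable1; [apply: k_differentiable_le d1|apply: k_differentiable_le d2].
Qed.

Lemma mx_k_differentiable_block n k (G H : 'rV[R]_j -> 'M[C]_n) x :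
  mx_k_differentiable k G x -> mx_k_differentiable k H x ->
  mx_k_differentiable k (fun y => block_mx (G y) (H y) 0 (G y)) x.
Proof.
move=> dG dH a b.
have E (P : C -> R) : P 0 = 0 -> (forall c d, k_differentiable k (fun y => P (G y c d)) x) ->
    (forall c d, k_differentiable k (fun y => P (H y c d)) x) ->
    k_differentiable k (fun y => P (block_mx (G y) (H y) 0 (G y) a b)) x.
  move=> P0 PG PH.
  case: (split_ordP a) => a' ->; case: (split_ordP b) => b' ->.
  - by under eq_fun do rewrite block_mxEul.
  - by under eq_fun do rewrite block_mxEur.
  - by under eq_fun do rewrite block_mxEdl mxE P0; exact: k_differentiable_cst.
  by under eq_fun do rewrite block_mxEdr.
by split; apply: E => // c d; case: (dG c d); case: (dH c d).
Qed.

Lemma mx_k_differentiable_block_derivative n k l d (G : 'rV[R]_j -> 'M[C]_n) x :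
  mx_k_differentiable (k + l) G x ->
  mx_k_differentiable l (block_derivative d G k) x.
Proof.
elim: k l => [|k IH] l //; rewrite addSnnS => /IH dX.
apply: mx_k_differentiable_block; first exact: mx_k_differentiable_pred.
exact: mx_k_differentiable_partial.
Qed.

Lemma eigenvalue_block_derivative n k d (G : 'rV[R]_j -> 'M[C]_n) x z :
  eigenvalue (block_derivative d G k x) z -> eigenvalue (G x) z.
Proof. by elim: k => [|k IH] //= /eigenvalue_block /IH. Qed.

Variables (f : R[i]^o -> R[i]^o) (Omega : set R[i]^o).
Hypothesis Oopen : open Omega.
Hypothesis fD : forall z, Omega z -> derivable f z 1.
Hypothesis f'C : forall z, Omega z -> {for z, continuous (derive1 f)}.

(* The partial derivatives of f o A are blocks of f o X_1, which is again of the
   form f o A with a matrix differentiable one time less. *)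
Lemma matfun_k_differentiable n k (A : 'rV[R]_j -> 'M[C]_n) x :
  mx_k_differentiable k A x -> (\forall y \near x, forall z, eigenvalue (A y) z -> Omega z) ->
  mx_k_differentiable k (fun y => matfun f (A y)) x.
Proof.
elim: k n A x => [|k IH] n A x // dA sp.
have dF y : mx_differentiable A y -> (forall z, eigenvalue (A y) z -> Omega z) ->
    mx_differentiable (fun y => matfun f (A y)) y.
  by move=> dy spy; have [] := matfun_differentiable Oopen fD f'C dy spy.
have d1 := dF x (mx_k_differentiable1 dA) (nbhs_singleton sp).
have d1n : (0 < k)%N -> \forall y \near x, mx_differentiable A y.
  case: k dA {IH} => // k dA _.
  by apply: filterS (mx_k_differentiable_nbhs dA) => y; exact: mx_k_differentiable1.
have d2n : (0 < k)%N -> \forall y \near x, mx_differentiable (fun y => matfun f (A y)) y.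
  by move=> /d1n h; apply: filterS2 h sp => y; exact: dF.
have dP i : mx_k_differentiable k (mx_partial i (fun y => matfun f (A y))) x.
  (* For [k = 0] nothing is claimed; for [k > 0], [A] is differentiable near [x], so the block
     formula holds on a neighborhood and can be differentiated further. *)
  case: (posnP k) => [->|k0]; first by [].
  pose X y := block_mx (A y) (mx_partial i A y) 0 (A y).
  have dX : mx_k_differentiable k (fun y => matfun f (X y)) x.
    apply: IH; last by apply: filterS sp => y h z /eigenvalue_block /h.
    apply: mx_k_differentiable_block; first exact: mx_k_differentiable_pred.
    exact: mx_k_differentiable_partial.
  apply: (@mx_k_differentiable_near _ _ (fun y => ursubmx (matfun f (X y)))).
    apply: filterS2 (d1n k0) sp => y dy spy.
    have [_ ->] := matfun_differentiable Oopen fD f'C dy spy.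
    by rewrite block_mxKur.
  move=> a b; have [h1 h2] := dX (lshift n a) (rshift n b).
  by split; [move: h1|move: h2]; congr k_differentiable; apply/funext => y; rewrite !mxE.
move=> a b; split; apply: k_differentiableS.
- by case: (d1 a b).
- by move=> /d2n; apply: filterS => y /(_ a b)[].
- move=> i; have [h _] := dP i a b; move: h.
  by congr k_differentiable; apply/funext => y; rewrite mxE.
- by case: (d1 a b).
- by move=> /d2n; apply: filterS => y /(_ a b)[].
move=> i; have [_ h] := dP i a b; move: h.
by congr k_differentiable; apply/funext => y; rewrite mxE.
Qed.

(** The induction hypothesis holds at all points near [x], since [A] is [k] times differentiable
    there, so both sides have the same partial derivatives at [x]. [matfun_differentiable] is then
    applied with the matrix [X_k], which is still differentiable at [x]. *)
Lemma matfun_block_derivative n k d (A : 'rV[R]_j -> 'M[C]_n) x :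
  mx_k_differentiable k A x -> (\forall y \near x, forall z, eigenvalue (A y) z -> Omega z) ->
  block_derivative d (fun y => matfun f (A y)) k x = matfun f (block_derivative d A k x).
Proof.
elim: k x => [|k IH] x // dA sp.
have FE : \forall y \near x,
    block_derivative d (fun y => matfun f (A y)) k y = matfun f (block_derivative d A k y).
  by apply: filterS2 (mx_k_differentiable_nbhs dA) (near_near sp) => y; exact: IH.
have dX : mx_differentiable (block_derivative d A k) x.
  apply: (@mx_k_differentiable1 _ 0).
  by apply: mx_k_differentiable_block_derivative; rewrite addn1.
have spX z : eigenvalue (block_derivative d A k x) z -> Omega z.
  by move=> /eigenvalue_block_derivative; exact: nbhs_singleton sp z.
rewrite /= (mx_partial_near _ FE) (nbhs_singleton FE).
by have [_ ->] := matfun_differentiable Oopen fD f'C dX spX.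
Qed.

End MatrixKDifferentiable.

Lemma cont_diff_on_C1 (R : realType) (N : nat) (Omega : set R[i]^o) (f : R[i]^o -> R[i]^o) :
  (0 < N)%N -> cont_diff_on N Omega f ->
  (forall z, Omega z -> derivable f z 1) /\
  (forall z, Omega z -> {for z, continuous (derive1 f)}).
Proof.
move=> N0 [fD fC]; split=> [|z Oz]; first exact: (fD 0%N).
case: (ltngtP N 1) N0 => // [N1 _|N1 _]; last by move: fC; rewrite N1; exact.
by apply: differentiable_continuous; apply/derivable1_diffP; exact: (fD 1%N).
Qed.

Theorem theorem2p1 (R : realType) (j k n m : nat)
    (hj : (1 <= j)%N) (hk : (1 <= k)%N) (hn : (1 <= n)%N) (hm : (1 <= m)%N)
    (Omega : set R[i]^o) (hOmega : open Omega)
    (A : 'rV[R]_j -> 'M[R[i]]_n) (xbar : 'rV[R]_j)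
    (hA : mx_k_differentiable k A xbar)
    (hAM : \forall x \near xbar, spectral_class Omega m (A x))
    (d : nat -> 'I_j)
    (f : R[i]^o -> R[i]^o)
    (hf : cont_diff_on (k.+1 * m - 1)%N Omega f) :
  mx_k_differentiable k (fun x => matfun f (A x)) xbar /\
  block_derivative d (fun x => matfun f (A x)) k xbar =
    matfun f (block_derivative d A k xbar).
Proof.
have N_gt0 : (0 < k.+1 * m - 1)%N by nia.
have [fD f'C] := cont_diff_on_C1 N_gt0 hf.
have sp : \forall y \near xbar, forall z, eigenvalue (A y) z -> Omega z.
  by apply: filterS hAM => y [].
split; first exact: (matfun_k_differentiable hOmega fD f'C hA sp).
exact: (matfun_block_derivative hOmega fD f'C d hA sp).
Qed.
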